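(* The bounded-volume Boolean disc model (defined in the context) satisfies Assumption H (stated in the context).
   Context: Model. Let $([0,1],\Sigma_{[0,1]},\mathcal P)$ be a separable probability space (the mark space $\mathcal E=[0,1]$), and $\{R_d\}_{d\ge1}$ a sequence of measurable functions $R_d:[0,1]\to\mathbb R_+$ such that there exist $0<c_1<1/\sqrt{8\pi \mathrm e}$ and $V^{(\max)}>0$ with $$c_1d^{1/2}\le R_d(a)\le \frac1{2\sqrt\pi}\big(V^{(\max)}\big)^{1/d}\,\Gamma\big(\tfrac d2+1\big)^{1/d}=:R_d^{(\max)}\qquad\text{for all }a\in[0,1],$$ and such that there exist $\epsilon>0$, $c_2>0$ with $\mathcal P\big(R_d>(1-\tfrac{c_2}d)R_d^{(\max)}\big)>\epsilon$ for all $d$. The connection function is $\varphi(\overline x;a,b)=\varphi_d(\overline x;a,b)=\mathbf 1\{|\overline x|\le R_d(a)+R_d(b)\}$ for $\overline x\in\mathbb R^d$, $a,b\in[0,1]$, i.e. $\varphi((\overline x,a),(\overline y,b))=\varphi(\overline x-\overline y;a,b)$ on $\mathbb X=\mathbb R^d\times\mathcal E$, and $\nu=\mathrm{Leb}\otimes\mathcal P$. Notation. $\widehat\varphi(k;a,b)=\int e^{ik\cdot\overline x}\varphi(\overline x;a,b)\,\mathrm d\overline x$, and $\widehat\Phi(k)$ is the integral operator on $L^2(\mathcal E,\mathcal P)$ with kernel $\widehat\varphi(k;a,b)$. For a bounded self-adjoint $H$, $\mathbb S(H)=\sup_{f\ne0}\langle f,Hf\rangle/\langle f,f\rangle$. For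 an integral operator $H$ on $L^2(\mathcal E)$ with kernel $h$, $\|H\|_{\infty,\infty}=\operatorname{ess\,sup}_{a,b}|h(a,b)|$. $\star$ is convolution over $\mathbb R^d$. Assumption H. (H.1) $\mathbb S(\widehat\Phi(0))<\infty$ for all $d$ and there is a $d$-independent $C>0$ with $\|\widehat\Phi(0)\|_{\infty,\infty}\le C\,\mathbb S(\widehat\Phi(0))$ and $\|\widehat\Phi(0)-\widehat\Phi(k)\|_{\infty,\infty}\le C(\mathbb S(\widehat\Phi(0))-\mathbb S(\widehat\Phi(k)))$ for all $k\in\mathbb R^d$. (H.2) There are $d$-independent $C_1\in(0,1)$, $C_2>0$ with $\mathbb S(\widehat\Phi(k))/\mathbb S(\widehat\Phi(0))\le C_1\vee(1-C_2|k|^2)$ for all $k$. (H.3) There is $g:\mathbb N\to\mathbb R_{\ge0}$ with $g(d)\to0$ as $d\to\infty$, with $$\mathbb S(\widehat\Phi(0))^{-3}\operatorname*{ess\,sup}_{\overline x\in\mathbb R^d,a_1,\dots,a_6\in\mathcal E}\big(\varphi(\cdot;a_1,a_2)\star\varphi(\cdot;a_3,a_4)\star\varphi(\cdot;a_5,a_6)\big)(\overline x)\le g(d),$$ and such that the sets $B(x)=\{y\in\mathbb X:\mathbb S(\widehat\Phi(0))^{-2}\int\varphi(x,u)\varphi(u,y)\nu(\mathrm du)>g(d)\}$ satisfy $\operatorname{ess\,sup}_{x\in\mathbb X}\nu(B(x))\le g(d)$. *)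

(* Defs.v *)
From HB Require Import structures.
From mathcomp Require Import all_boot all_order all_algebra.
From mathcomp Require Import all_classical all_reals all_analysis.
From mathcomp Require Import ess_sup_inf hoelder complex.

Set Implicit Arguments.
Unset Strict Implicit.
Unset Printing Implicit Defensive.

Import Order.TTheory GRing.Theory Num.Theory.
Import numFieldNormedType.Exports.

Local Open Scope classical_set_scope.
Local Open Scope ring_scope.

Section lebesgue_measure_vec.
Context {R : realType}.

Definition vcons d (p : measurableTypeR R * d.-tuple R) : d.+1.-tuple R :=
  [the d.+1.-tuple R of (p.1 : R) :: p.2].

Lemma measurable_vcons d : measurable_fun setT (@vcons d).
Proof. exact: measurable_cons. Qed.

Section step.
Context d (mu : {sigma_finite_measure set (d.-tuple R) -> \bar R}).

Definition leb_step : set (d.+1.-tuple R) -> \bar R :=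
  pushforward (@lebesgue_measure R \x mu)%E (@vcons d).

Let leb_step0 : leb_step set0 = 0%E.
Proof. by rewrite /leb_step /pushforward preimage_set0 measure0. Qed.

Let leb_step_ge0 A : (0 <= leb_step A)%E.
Proof.
exact: (measure_ge0 ((@lebesgue_measure R \x mu)%E : {measure set _ -> \bar R})).
Qed.

Let leb_step_sigma_additive : semi_sigma_additive leb_step.
Proof.
pose m : {measure set (measurableTypeR R * d.-tuple R) -> \bar R} :=
  (@lebesgue_measure R \x mu)%E.
move=> F mF tF mUF.
rewrite /leb_step /pushforward preimage_bigcup.
have mpre A : measurable A -> measurable (@vcons d @^-1` A).
  by move=> mA; rewrite -[X in measurable X]setTI; exact: measurable_vcons.
apply: (@measure_semi_sigma_additive _ _ _ m).
- by move=> n; exact: mpre.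
- apply/trivIsetP => /= i j _ _ ij; rewrite -preimage_setI.
  by move/trivIsetP : tF => /(_ _ _ _ _ ij) ->//; rewrite preimage_set0.
- by rewrite -preimage_bigcup; exact: mpre.
Qed.

HB.instance Definition _ := isMeasure.Build _ _ _ leb_step
  leb_step0 leb_step_ge0 leb_step_sigma_additive.

Let leb_step_sigma_finite : sigma_finite setT leb_step.
Proof.
have /sigma_finiteP[F [TF ndF Foo]] := sigma_finiteT (@lebesgue_measure R).
have /sigma_finiteP[G [TG ndG Goo]] := sigma_finiteT mu.
pose u (x : d.+1.-tuple R) : (measurableTypeR R * d.-tuple R)%type :=
  (thead x, [tuple of behead x]).
have mu_ : measurable_fun setT u.
  apply: measurable_fun_pair => /=.
    exact: (@measurable_tnth _ R d.+1 ord0).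
  exact: measurable_behead.
have vK : cancel (@vcons d) u.
  by case=> a b; congr pair; apply/val_inj.
exists (fun n => u @^-1` (F n `*` G n)).
  apply/seteqP; split => // x _.
  have [k _ Fk] : (\bigcup_n F n) (thead x) by rewrite -TF.
  have [l _ Gl] : (\bigcup_n G n) [tuple of behead x] by rewrite -TG.
  exists (maxn k l) => //; split => /=.
    by move: Fk; exact/subsetPset/ndF/leq_maxl.
  by move: Gl; exact/subsetPset/ndG/leq_maxr.
move=> n; have [mFn Fnoo] := Foo n; have [mGn Gnoo] := Goo n; split.
  by rewrite -[X in measurable X]setTI; apply: mu_ => //; exact: measurableX.
rewrite /leb_step /pushforward.
have -> : @vcons d @^-1` (u @^-1` (F n `*` G n)) = F n `*` G n.
  rewrite -comp_preimage (_ : u \o @vcons d = id) ?preimage_id//.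
  by apply/funext => x; exact: vK.
by rewrite product_measure1E// lte_mul_pinfty// ge0_fin_numE.
Qed.

HB.instance Definition _ := Measure_isSigmaFinite.Build _ _ _ leb_step
  leb_step_sigma_finite.

End step.

(* Lebesgue measure on R^d (with R^0 a point): the image of the product measure
   of [lebesgue_measure] on R and Lebesgue measure on R^(d-1). *)
Fixpoint leb (d : nat) : {sigma_finite_measure set (d.-tuple R) -> \bar R} :=
  match d with
  | 0 => (\d_ [tuple])%E
  | d'.+1 => leb_step (leb d')
  end.

End lebesgue_measure_vec.

Section vectors.
Context {R : realType} {d : nat}.
Implicit Types x y : d.-tuple R.

Definition vzero : d.-tuple R := [tuple 0 | _ < d].

Definition vsub x y : d.-tuple R := [tuple tnth x i - tnth y i | i < d].

Definition dotv x y : R := \sum_(i < d) tnth x i * tnth y i.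

Definition enorm x : R := Num.sqrt (dotv x x).

(* f and g are nonnegative in all uses, so the integral is always meaningful. *)
Definition conv (f g : d.-tuple R -> \bar R) (x : d.-tuple R) : \bar R :=
  (\int[leb d]_y (f y * g (vsub x y)))%E.

End vectors.

Section complex_integrals.
Context {R : realType}.

Definition cis (t : R) : R[i] := (cos t +i* sin t)%C.

(* Componentwise integral, meaningful when f is integrable. *)
Definition cintegral dT (T : measurableType dT)
    (mu : {measure set T -> \bar R}) (f : T -> R[i]) : R[i] :=
  ((\int[mu]_x complex.Re (f x)) +i* (\int[mu]_x complex.Im (f x)))%C.

End complex_integrals.

(* Elements of L^2(E, P) are represented by functions; being nonzero in L^2
   means not vanishing P-almost everywhere. *)
Section L2.
Context {R : realType} {dE : measure_display} {E : measurableType dE}.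
Variable P : probability E R.
Implicit Types (f g : E -> R[i]) (h : E -> E -> R[i]).

Definition L2 f : Prop :=
  (@complex.Re R \o f \in Lfun P 2%:E) /\ (@complex.Im R \o f \in Lfun P 2%:E).

Definition inner f g : R[i] := cintegral P (fun a => f a * (g a)^*%C).

Definition int_op h f : E -> R[i] :=
  fun a => cintegral P (fun b => h a b * f b).

(* The quotient is a real number when H is self-adjoint; [complex.Re] only
   changes its type. *)
Definition sup_spec (H : (E -> R[i]) -> E -> R[i]) : \bar R :=
  ereal_sup [set (complex.Re (inner f (H f) / inner f f))%:E
            | f in [set f | L2 f /\ ~ (\forall a \ae P, f a = 0)]].

Definition norm_oo h : \bar R :=
  ess_sup (P \x P)%E (fun ab => (Normc.normc (h ab.1 ab.2))%:E).

End L2.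

Section assumption_H.
Context {R : realType} {dE : measure_display} {E : measurableType dE}.
Variable P : probability E R.

Section fixed_dimension.
Context {d : nat}.
Variable phi : d.-tuple R -> E -> E -> R.

Definition phi_hat (k : d.-tuple R) (a b : E) : R[i] :=
  cintegral (leb d) (fun x => cis (dotv k x) * ((phi x a b)%:C)%C).

Definition S_Phi_hat (k : d.-tuple R) : \bar R :=
  sup_spec P (int_op P (phi_hat k)).

Definition nu : {measure set (d.-tuple R * E) -> \bar R} := (leb d \x P)%E.

Definition phi_X (x y : d.-tuple R * E) : R := phi (vsub x.1 y.1) x.2 y.2.

Definition triple_conv_sup : \bar R :=
  ess_sup (leb d \x P \x P \x P \x P \x P \x P)%E
    (fun w : d.-tuple R * E * E * E * E * E * E =>
       let: (x, a1, a2, a3, a4, a5, a6) := w in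
       let p a b := fun y => (phi y a b)%:E in
       conv (conv (p a1 a2) (p a3 a4)) (p a5 a6) x).

Definition bad_set (t : R) (x : d.-tuple R * E) : set (d.-tuple R * E) :=
  [set y | ((S_Phi_hat vzero)^-1 ^+ 2 *
            \int[nu]_u (phi_X x u * phi_X u y)%:E > t%:E)%E].

End fixed_dimension.

Variable phi : forall d : nat, d.-tuple R -> E -> E -> R.
Arguments phi : clear implicits.

Definition H1 : Prop :=
  (forall d, (0 < d)%N -> (S_Phi_hat (phi d) vzero < +oo)%E) /\
  exists C : R, 0 < C /\
    forall d, (0 < d)%N ->
      (norm_oo P (phi_hat (phi d) vzero) <= C%:E * S_Phi_hat (phi d) vzero)%E /\
      forall k : d.-tuple R,
        (norm_oo P
            (fun a b => phi_hat (phi d) vzero a b - phi_hat (phi d) k a b)%R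
          <= C%:E * (S_Phi_hat (phi d) vzero - S_Phi_hat (phi d) k))%E.

Definition H2 : Prop :=
  exists C1 C2 : R, [/\ 0 < C1, C1 < 1, 0 < C2 &
    forall d, (0 < d)%N -> forall k : d.-tuple R,
      (S_Phi_hat (phi d) k / S_Phi_hat (phi d) vzero
        <= (Num.max C1 (1 - C2 * enorm k ^+ 2))%:E)%E].

Definition H3 : Prop :=
  exists g : nat -> R, [/\ forall d, 0 <= g d, g @ \oo --> (0 : R) &
    forall d, (0 < d)%N ->
      ((S_Phi_hat (phi d) vzero)^-1 ^+ 3 * triple_conv_sup (phi d)
        <= (g d)%:E)%E /\
      (ess_sup nu (fun x => nu (bad_set (phi d) (g d) x)) <= (g d)%:E)%E].

Definition AssumptionH : Prop := [/\ H1, H2 & H3].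

End assumption_H.

(* Separability of a measure space: the sets of the sigma-algebra have a
   countable dense subset for the pseudometric (A, B) |-> mu (A symdiff B). *)
Definition separable_measure {R : realType} dT (T : measurableType dT)
    (mu : {measure set T -> \bar R}) : Prop :=
  exists D : nat -> set T, (forall n, measurable (D n)) /\
    forall A, measurable A -> forall e : R, 0 < e ->
      exists n, (mu (A `+` D n) < e%:E)%E.

(* The mark space [0,1].  A sigma-algebra Sigma on it is the collection of
   measurable sets of [g_sigma_algebraType Sigma]
   (see measurable_g_measurableTypeE). *)
Definition unit_itv (R : realType) := {x : R | 0 <= x <= 1}.

Lemma zero_in_unit_itv (R : realType) : 0 <= (0 : R) <= 1.
Proof. by rewrite lexx ler01. Qed.

HB.instance Definition _ (R : realType) :=
  Choice.copy (unit_itv R) {x : R | 0 <= x <= 1}.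
HB.instance Definition _ (R : realType) :=
  isPointed.Build (unit_itv R) (exist _ 0 (zero_in_unit_itv R)).

Section boolean_disc_model.
Context {R : realType}.

Definition Gamma (s : R) : R :=
  \int[@lebesgue_measure R]_(t in `]0, +oo[) (t `^ (s - 1) * expR (- t)).

Definition R_max (V : R) (d : nat) : R :=
  (2 * Num.sqrt pi)^-1 * V `^ d%:R^-1 * Gamma (d%:R / 2 + 1) `^ d%:R^-1.

Definition boolean_disc (E : Type) (rad : nat -> E -> R) (d : nat)
    (x : d.-tuple R) (a b : E) : R :=
  (enorm x <= rad d a + rad d b)%R%:R.

End boolean_disc_model.

(* Main.v *)
Require Import Defs.
From mathcomp Require Import all_boot all_order all_algebra.
From mathcomp Require Import all_classical all_reals all_analysis.
From mathcomp Require Import measurable_realfun ess_sup_inf hoelder complex.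
From mathcomp Require Import ring lra.

Set Implicit Arguments.
Unset Strict Implicit.
Unset Printing Implicit Defensive.

Import Order.TTheory GRing.Theory Num.Theory.
Import numFieldNormedType.Exports.

Local Open Scope classical_set_scope.
Local Open Scope ring_scope.

(** Why the disc model satisfies the assumption.  Let [D] be twice the maximal
    radius.  The normalisation of [R_max] says that the ball of radius [D] has
    volume [V] in every dimension ([omega_R_max], which rests on integrating the
    Gaussian over balls, [omega_Gamma]), and comparing the unit ball with its
    inscribed cube gives [D <= C * sqrt d] ([diameter_le]).  The kernel of the
    Fourier operator is real: its entries are the integrals [cosint k r] of
    [cos (k . x)] over balls whose radius [r] is a sum of two radii of discs.

    The spectral conditions [H1] and [H2].  The spectral supremum [S(0)] is at
    most [V], and bounded below uniformly in the dimension by testing with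
    indicator functions ([S_Phi_hat_uniform]).  About [S(k)] only one fact is
    needed, the entrywise damping
      [|cosint k r| <= (1 - min(1/4, c |k|^2)) * cosint 0 r]
    with [c] independent of the dimension ([cosint_le], [kernel_damped]): a
    kernel dominated by a multiple of a nonnegative kernel has its supremum
    dominated by the same multiple ([form_le_dominated]).  To prove the damping,
    turn [k] onto the first axis ([integral_leb_direction]) and cut the ball
    into chords in that direction.  On a chord of half-length [s] the mean of
    the cosine is [sin (|k| s) / (|k| s)], whose distance from 1 and -1 is at
    least of order [min(1, |k|^2 s^2)] ([sinc_bound]).  As [r] is at least of order [sqrt d], half of the volume
    of the ball lies on chords whose half-length is bounded below
    ([cosball_ge]).  In the other direction, [cosint 0 r - cosint k r] is at most
    half of the second moment of the ball in direction [k], which is at most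
    [|k|^2 r^2 / d] times its volume because the [d] axes share the integral of
    the squared norm ([ball_second_moment]); since [r <= D], this is bounded by
    a multiple of [|k|^2], that is, of [S(0) - S(k)].

    The geometric condition [H3].  Every ball may be enlarged to radius [D].
    Two such balls with centres at distance at least [D / 2] have an overlap of
    volume at most [V q^d] with [q = sqrt (15/16)] ([overlap_far]), and the ball
    of radius [D / 2] has volume [V / 2^d].  Hence triple convolutions are of
    order [q^d] ([triple_conv_le]), and two points with many two-step
    connections are within distance [D / 2] ([nu_bad_set_le]). *)

(** * Affine substitution on the line *)

Section pushforward_meas.
Context d1 d2 (T1 : measurableType d1) (T2 : measurableType d2) (R : realType).
Variables (mu : {measure set T1 -> \bar R}) (f : T1 -> T2).
Variable mf : measurable_fun setT f.

(** The set function [pushforward], packaged with the proof that makes it a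
    measure. *)
Definition pushforward_meas : {measure set T2 -> \bar R} :=
  measure_function_pushforward__canonical__measure_function_Measure mu mf.

Lemma ge0_integral_pushforward_meas (g : T2 -> \bar R) :
  measurable_fun setT g -> (forall y, 0 <= g y)%E ->
  (\int[pushforward_meas]_y g y = \int[mu]_x g (f x))%E.
Proof. by move=> mg g0; rewrite ge0_integral_pushforward. Qed.

End pushforward_meas.

Section affine_substitution.
Context {R : realType}.
Implicit Types (a b : R) (f : R -> \bar R).
Local Notation mu := (@lebesgue_measure R).

Lemma measurable_affine a b : measurable_fun setT (fun x : R => a * x + b).
Proof.
by apply: measurable_funD => //; exact: measurable_funM.
Qed.

Lemma lebesgue_measure_affine_pos a b (A : set R) : 0 < a -> measurable A ->
  (a%:E * mu ((fun x : R => a * x + b)%R @^-1` A))%E = mu A.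
Proof.
move=> a0 mA.
pose ab := (fun x : measurableTypeR R => (a * x + b)%R : measurableTypeR R).
have mab : measurable_fun setT ab by exact: measurable_affine.
pose m : {measure set (measurableTypeR R) -> \bar R} :=
  mscale (NngNum (ltW a0)) (pushforward_meas mu mab).
suff /(_ _ mA) <- : forall X, measurable X -> m X = mu X by [].
move=> X mX; apply/esym/lebesgue_measure_unique => //= _ [[x y]] _ <- /=.
rewrite /m /mscale /pushforward /=.
have pre : ab @^-1` `]x, y]%classic = `](x - b) / a, (y - b) / a]%classic.
  apply/seteqP; split => z /=; rewrite !in_itv/= /ab;
  by rewrite ltr_pdivrMr// ler_pdivlMr// ltrBlDr lerBrDr [z * a]mulrC.
rewrite [pushforward _ _ _](congr1 mu pre).
rewrite !lebesgue_measure_itv/= !lte_fin ltr_pM2r ?invr_gt0// ltrD2r.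
case: ifPn => // _; last by rewrite mule0.
rewrite -!EFinB -EFinM; congr (_%:E); field; exact: lt0r_neq0.
Qed.

(** The one-dimensional substitution to which every change of variables below
    is reduced by Tonelli's theorem. *)
Lemma ge0_integral_affine a b f : a != 0 -> measurable_fun setT f ->
  (forall x, 0 <= f x)%E ->
  (\int[mu]_x f (a * x + b)%R = `|a|^-1%:E * \int[mu]_x f x)%E.
Proof.
move=> a0 mf f0.
wlog a_gt0 : a a0 b / 0 < a.
  move=> H; have [ag0|al0|ae] := ltgtP 0 a.
  - exact: H.
  - rewrite -normrN -(H (- a) _ b) ?oppr_eq0 ?oppr_gt0//.
    have mfab : measurable_fun setT (fun x => f (a * x + b)).
      by apply: measurableT_comp => //; exact: measurable_affine.
    have mN : measurable_fun setT (-%R : measurableTypeR R -> measurableTypeR R).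
      exact: oppr_measurable.
    transitivity (\int[pushforward_meas mu mN]_x
        f (a * x + b)%R)%E.
      by apply: eq_measure_integral => A mA _; apply/esym/lebesgue_measureN.
    rewrite ge0_integral_pushforward_meas//=.
    by apply: eq_integral => x _ /=; rewrite mulrN mulNr.
  - by rewrite -ae eqxx in a0.
pose ab := (fun x : measurableTypeR R => (a * x + b)%R : measurableTypeR R).
have mab : measurable_fun setT ab by exact: measurable_affine.
pose m : {measure set (measurableTypeR R) -> \bar R} :=
  mscale (NngNum (ltW a_gt0)) (pushforward_meas mu mab).
have -> : (\int[mu]_x f x = \int[m]_x f x)%E.
  apply: eq_measure_integral => A mA _.
  by apply/esym; exact: lebesgue_measure_affine_pos.
rewrite ge0_integral_mscale//= ge0_integral_pushforward_meas//=.
rewrite muleA -EFinM (gtr0_norm a_gt0) mulVf ?gt_eqF// mul1e.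
by apply: eq_integral.
Qed.

End affine_substitution.

Section measurability.
Context {R : realType}.

Lemma measurable_dotvl d (k : d.-tuple R) : measurable_fun setT (dotv k).
Proof.
apply: measurable_sum => i; apply: measurable_funM => //.
exact: measurable_tnth.
Qed.

Lemma measurable_sqnorm d : measurable_fun setT (fun x : d.-tuple R => dotv x x).
Proof.
apply: measurable_sum => i.
by apply: measurable_funM; exact: measurable_tnth.
Qed.

Lemma measurable_sqrt : measurable_fun setT (@Num.sqrt R).
Proof. by apply: continuous_measurable_fun => x; exact: sqrt_continuous. Qed.

Lemma measurable_enorm d : measurable_fun setT (@enorm R d).
Proof.
apply: (measurableT_comp measurable_sqrt); exact: measurable_sqnorm.
Qed.

Lemma measurable_vsub d : measurable_fun setT
  (fun p : d.-tuple R * d.-tuple R => vsub p.1 p.2).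
Proof.
apply/measurable_fun_tnthP => i /=.
rewrite (_ : _ \o _ = (fun p : d.-tuple R * d.-tuple R =>
  tnth p.1 i - tnth p.2 i)); last by apply/funext => p /=; rewrite tnth_mktuple.
by apply: measurable_funB;
  apply: (measurableT_comp (f := fun x => tnth x i)) => //;
  exact: measurable_tnth.
Qed.

End measurability.

(** * Tonelli and affine substitution in several variables *)

Section leb_integral.
Context {R : realType}.
Local Notation mu := (@lebesgue_measure R).

Lemma dotv_vcons n (t u : R) (y z : n.-tuple R) :
  dotv (vcons (t, y)) (vcons (u, z)) = t * u + dotv y z.
Proof.
rewrite /dotv big_ord_recl; congr (_ + _).
by apply: eq_bigr => i _; rewrite !tnthS.
Qed.

Lemma vcons_eta n (x : n.+1.-tuple R) :
  x = vcons (thead x, [tuple of behead x]).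
Proof. by rewrite [LHS]tuple_eta; apply/val_inj. Qed.

Lemma integral_leb_cons n (F : n.+1.-tuple R -> \bar R) :
  measurable_fun setT F -> (forall x, 0 <= F x)%E ->
  (\int[leb n.+1]_x F x = \int[leb n]_y \int[mu]_t F (vcons (t, y)))%E.
Proof.
move=> mF F0.
pose m : {measure set (measurableTypeR R * n.-tuple R) -> \bar R} :=
  (mu \x leb n)%E.
transitivity (\int[pushforward_meas m (@measurable_vcons R n)]_x F x)%E.
  exact: eq_measure_integral.
rewrite ge0_integral_pushforward_meas//.
rewrite (fubini_tonelli1 (m1 := mu) (m2 := leb n) (fun p => F (vcons p)))//.
  rewrite -(fubini_tonelli (m1 := mu) (m2 := leb n) (fun p => F (vcons p)))//.
  by apply: (measurableT_comp mF); exact: measurable_vcons.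
by apply: (measurableT_comp mF); exact: measurable_vcons.
Qed.

(** Dilations, reflections and translations at once. *)
Definition vaff d a (v x : d.-tuple R) : d.-tuple R :=
  [tuple a * tnth x i + tnth v i | i < d].

Lemma measurable_vaff d a (v : d.-tuple R) : measurable_fun setT (vaff a v).
Proof.
apply/measurable_fun_tnthP => i /=.
rewrite (_ : _ \o _ = (fun x => a * tnth x i + tnth v i)); last first.
  by apply/funext => x /=; rewrite tnth_mktuple.
apply: measurable_funD => //; apply: measurable_funM => //.
exact: measurable_tnth.
Qed.

Lemma vaff_vcons n a t u (v x : n.-tuple R) :
  vaff a (vcons (u, v)) (vcons (t, x)) = vcons (a * t + u, vaff a v x).
Proof.
apply: eq_from_tnth => i; rewrite tnth_mktuple.
case: (unliftP ord0 i) => [j|] ->; last by [].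
by rewrite !tnthS tnth_mktuple.
Qed.

Lemma ge0_integral_vaff d a (v : d.-tuple R) (F : d.-tuple R -> \bar R) :
  a != 0 -> measurable_fun setT F -> (forall x, 0 <= F x)%E ->
  (\int[leb d]_x F (vaff a v x) = (`|a| ^- d)%:E * \int[leb d]_x F x)%E.
Proof.
move=> a0; elim: d v F => [|n IH] v F mF F0.
  rewrite expr0 invr1 mul1e; apply: eq_integral => x _; congr F.
  by rewrite (tuple0 x) (tuple0 (vaff _ _ _)).
rewrite (vcons_eta v); set u := thead v; set w := [tuple of behead v].
have mFa : measurable_fun setT (fun x => F (vaff a (vcons (u, w)) x)).
  by apply: (measurableT_comp mF); exact: measurable_vaff.
rewrite integral_leb_cons//.
under eq_integral => y _.
  under eq_integral do rewrite vaff_vcons.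
  rewrite (@ge0_integral_affine _ a u (fun t => F (vcons (t, vaff a w y))))//; last first.
    apply: (measurableT_comp mF).
    by apply: (measurableT_comp (@measurable_vcons _ _)); exact: measurable_fun_pair.
  over.
have mG : measurable_fun setT (fun y => \int[mu]_t F (vcons (t, y)))%E.
  apply: (measurable_fun_fubini_tonelli_G (m1 := mu) (fun p => F (vcons p))) => //.
  by apply: (measurableT_comp mF); exact: measurable_vcons.
have G0 y : (0 <= \int[mu]_t F (vcons (t, y)))%E by exact: integral_ge0.
rewrite ge0_integralZl//; last first.
  by apply: (measurableT_comp mG); exact: measurable_vaff.
rewrite (IH w (fun y => \int[mu]_t F (vcons (t, y))))%E//.
rewrite integral_leb_cons// muleA -EFinM; congr (_%:E * _)%E.
by rewrite exprS invfM mulrC.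
Qed.

End leb_integral.

(** * Rotation invariance *)

Section rotation.
Context {R : realType}.
Local Notation mu := (@lebesgue_measure R).

(** Tonelli's theorem and one affine substitution in each variable: for fixed
    [y], [u = c x + s y] replaces [x] with slope [c]; then for fixed [u] the
    second coordinate is [(y - s u) / c], of slope [1 / c] in [y], so that the
    two Jacobians cancel.  For [c = 0] the rotation exchanges the variables. *)
Lemma integral_plane_rotation (c s : R)
    (H : measurableTypeR R * measurableTypeR R -> \bar R) :
  c ^+ 2 + s ^+ 2 = 1 -> measurable_fun setT H -> (forall p, 0 <= H p)%E ->
  (\int[mu]_x \int[mu]_y H (c * x + s * y, c * y - s * x)%R =
   \int[mu]_x \int[mu]_y H (x, y))%E.
Proof.
move=> cs mH H0.
have mid : measurable_fun setT (fun x : measurableTypeR R => (x : R)) by [].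
have m1 (x : R) : measurable_fun setT (fun y : R => H (x, y)).
  by apply: (measurableT_comp mH); exact: measurable_fun_pair.
have m2 (y : R) : measurable_fun setT (fun x : R => H (x, y)).
  by apply: (measurableT_comp mH); exact: measurable_fun_pair.
have [c0|c0] := eqVneq c 0.
  have s2 : s ^+ 2 = 1 by rewrite -cs c0 expr0n add0r.
  have sn : s != 0.
    by apply/eqP => s0; move: s2; rewrite s0 expr0n => /esym/eqP; rewrite oner_eq0.
  have ns : `|s| = 1 by apply/eqP; rewrite -sqrp_eq1// real_normK ?num_real ?s2.
  transitivity (\int[mu]_x \int[mu]_u H (u, - s * x + 0)%R)%E.
    apply: eq_integral => x _.
    have := @ge0_integral_affine _ s 0 (fun u => H (u, - s * x + 0)) sn (m2 _) (fun=> H0 _).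
    rewrite ns invr1 mul1e => <-; apply: eq_integral => y _; congr H.
    by rewrite c0 !mul0r add0r !addr0 sub0r mulNr.
  rewrite (fubini_tonelli (m1 := mu) (m2 := mu) (fun p => H (p.2, - s * p.1 + 0)))//.
    apply: eq_integral => u _.
    rewrite (@ge0_integral_affine _ (- s) 0 (fun v => H (u, v)))// ?oppr_eq0//.
    by rewrite normrN ns invr1 mul1e.
  apply: (measurableT_comp mH); apply: measurable_fun_pair => //=.
  apply: measurable_funD => //; apply: measurable_funM => //.
have msh : measurable_fun setT
    (fun p : measurableTypeR R * measurableTypeR R => H (p.2, c^-1 * p.1 + - (s * p.2 / c))).
  apply: (measurableT_comp mH); apply: measurable_fun_pair => //=.
  apply: measurable_funD; first exact: measurable_funM.
  by apply: measurableT_comp => //; apply: measurable_funM => //; exact: measurable_funM.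
rewrite (fubini_tonelli (m1 := mu) (m2 := mu)
  (fun p => H (c * p.1 + s * p.2, c * p.2 - s * p.1)))//; last first.
  apply: (measurableT_comp mH); apply: measurable_fun_pair => /=.
    by apply: measurable_funD; exact: measurable_funM.
  by apply: measurable_funB; exact: measurable_funM.
transitivity (\int[mu]_y (`|c|^-1%:E * \int[mu]_u H (u, c^-1 * y + - (s * u / c))%R))%E.
  apply: eq_integral => y _.
  rewrite -(@ge0_integral_affine _ c (s * y) (fun u => H (u, c^-1 * y + - (s * u / c))))//.
    apply: eq_integral => x _; congr (H (_, _)).
    apply/eqP; rewrite -subr_eq0 /=; apply/eqP.
    transitivity ((c ^+ 2 + s ^+ 2 - 1) * y / c); first by field.
    by rewrite cs subrr !mul0r.
  exact: (measurableT_comp msh (pair1_measurable y)).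
rewrite ge0_integralZl//; first last.
- by move=> y _; exact: integral_ge0.
- exact: (measurable_fun_fubini_tonelli_F (m2 := mu) _ msh).
rewrite (fubini_tonelli (m1 := mu) (m2 := mu) (fun p => H (p.2, c^-1 * p.1 + - (s * p.2 / c))))//.
have mI : measurable_fun setT (fun x => \int[mu]_y H (x, y))%E.
  exact: (measurable_fun_fubini_tonelli_F (m2 := mu) _ mH).
transitivity (`|c|^-1%:E * \int[mu]_u (`|c|%:E * \int[mu]_v H (u, v)))%E.
  congr (_ * _)%E; apply: eq_integral => u _.
  rewrite (@ge0_integral_affine _ c^-1 (- (s * u / c)) (fun v => H (u, v)))// ?invr_eq0//.
  by rewrite normfV invrK.
rewrite ge0_integralZl//; first by rewrite muleA -EFinM mulVf ?mul1e// normr_eq0.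
by move=> x _; exact: integral_ge0.
Qed.

End rotation.

Section direction.
Context {R : realType}.
Local Notation mu := (@lebesgue_measure R).

Lemma measurable_thead n : measurable_fun setT (@thead n R).
Proof. exact: measurable_tnth. Qed.

Lemma theadE n (t : R) (y : n.-tuple R) : thead (vcons (t, y)) = t.
Proof. by []. Qed.

Lemma behead_vcons n (t : R) (y : n.-tuple R) :
  [tuple of behead (vcons (t, y))] = y.
Proof. exact/val_inj. Qed.

Lemma dotv_ge0 d (x : d.-tuple R) : 0 <= dotv x x.
Proof. by apply: sumr_ge0 => i _; rewrite -expr2 sqr_ge0. Qed.

Lemma enorm_ge0 d (x : d.-tuple R) : 0 <= enorm x.
Proof. exact: sqrtr_ge0. Qed.

Lemma sqr_enorm d (x : d.-tuple R) : enorm x ^+ 2 = dotv x x.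
Proof. by rewrite sqr_sqrtr// dotv_ge0. Qed.

Lemma enorm_le d (x : d.-tuple R) r : 0 <= r ->
  (enorm x <= r) = (dotv x x <= r ^+ 2).
Proof. by move=> r0; rewrite -sqr_enorm ler_sqr ?nnegrE// enorm_ge0. Qed.

Lemma integral_leb_cons2 n (F : n.+2.-tuple R -> \bar R) :
  measurable_fun setT F -> (forall x, 0 <= F x)%E ->
  (\int[leb n.+2]_x F x =
   \int[leb n]_z \int[mu]_t \int[mu]_u F (vcons (t, vcons (u, z))))%E.
Proof.
move=> mF F0; rewrite integral_leb_cons//.
have mF1 : measurable_fun setT
    (fun p : measurableTypeR R * n.+1.-tuple R => F (vcons p)).
  by apply: (measurableT_comp mF); exact: measurable_vcons.
have mG : measurable_fun setT (fun y => \int[mu]_t F (vcons (t, y)))%E.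
  exact: (measurable_fun_fubini_tonelli_G (m1 := mu) _ mF1).
have G0 y : (0 <= \int[mu]_t F (vcons (t, y)))%E by exact: integral_ge0.
rewrite (integral_leb_cons mG G0).
apply: eq_integral => z _.
rewrite (fubini_tonelli (m1 := mu) (m2 := mu)
  (fun p => F (vcons (p.2, vcons (p.1, z)))))//.
apply: (measurableT_comp mF1); apply: measurable_fun_pair => //=.
by apply: (measurableT_comp (@measurable_vcons R n)); exact: measurable_fun_pair.
Qed.

(** Rotation invariance in the only form used below: a function of the scalar
    product with [k] and of the norm may be integrated as if [k] pointed along
    the first axis.  Induction on the dimension reduces this to rotating one
    coordinate plane at a time. *)
Lemma integral_leb_direction n (k : n.+1.-tuple R) (F : R * R -> \bar R) :
  measurable_fun setT F -> (forall p, 0 <= F p)%E ->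
  (\int[leb n.+1]_x F (dotv k x, dotv x x) =
   \int[leb n.+1]_x F (enorm k * thead x, dotv x x)%R)%E.
Proof.
move=> mF F0.
have mL d (l : d.-tuple R) (a : R) :
    measurable_fun setT (fun x : d.-tuple R => F (a + dotv l x, dotv x x)).
  apply: (measurableT_comp mF); apply: measurable_fun_pair => /=.
    by apply: measurable_funD => //; exact: measurable_dotvl.
  exact: measurable_sqnorm.
have mR d (a : R) : measurable_fun setT (fun x : d.+1.-tuple R => F (a * thead x, dotv x x)).
  apply: (measurableT_comp mF); apply: measurable_fun_pair => /=.
    by apply: measurable_funM => //; exact: measurable_thead.
  exact: measurable_sqnorm.
elim: n k F mF F0 mL mR => [|n IH] k F mF F0 mL mR.
  have mk : measurable_fun setT (fun x : 1.-tuple R => F (dotv k x, dotv x x)).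
    by have := mL _ k 0; under eq_fun do rewrite add0r.
  rewrite (integral_leb_cons mk (fun=> F0 _)).
  rewrite (integral_leb_cons (mR _ _) (fun=> F0 _)).
  apply: eq_integral => y _.
  rewrite (vcons_eta k) (tuple0 [tuple of behead k]); set a := thead k.
  have -> : enorm (vcons (a, [tuple])) = `|a|.
    by rewrite /enorm dotv_vcons /dotv big_ord0 addr0 -expr2 sqrtr_sqr.
  have [a0|a0] := leP 0 a.
    rewrite ger0_norm//; apply: eq_integral => t _; congr (F (_, _)).
    by rewrite dotv_vcons theadE (tuple0 y) /dotv big_ord0 addr0.
  have m1 : measurable_fun setT (fun t : R => F (`|a| * t, t * t + dotv y y)).
    apply: (measurableT_comp mF); apply: measurable_fun_pair => /=.
      exact: measurable_funM.
    by apply: measurable_funD => //; exact: measurable_funM.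
  transitivity (\int[mu]_t F (`|a| * t, t * t + dotv y y)%R)%E; last first.
    by apply: eq_integral => t _; rewrite dotv_vcons.
  have := ge0_integral_affine 0 (_ : -1 != 0) m1 (fun=> F0 _).
  rewrite normrN normr1 invr1 mul1e => <-; last by rewrite oppr_eq0 oner_eq0.
  apply: eq_integral => t _; rewrite !dotv_vcons ltr0_norm//; congr (F (_, _)).
    by rewrite (tuple0 y) /dotv big_ord0; ring.
  by congr (_ + _); ring.
rewrite (vcons_eta k); set k0 := thead k; set k' := [tuple of behead k].
have mk : measurable_fun setT (fun x : n.+2.-tuple R =>
    F (dotv (vcons (k0, k')) x, dotv x x)).
  by have := mL _ (vcons (k0, k')) 0; under eq_fun do rewrite add0r.
have mj : measurable_fun setT (fun x : n.+2.-tuple R =>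
    F (k0 * thead x + enorm k' * thead [tuple of behead x], dotv x x)).
  apply: (measurableT_comp mF); apply: measurable_fun_pair => /=; last first.
    exact: measurable_sqnorm.
  apply: measurable_funD; apply: measurable_funM => //; first exact: measurable_thead.
  by apply: (measurableT_comp (@measurable_thead _)); exact: measurable_behead.
(* The induction hypothesis, applied in the last n + 1 coordinates. *)
transitivity (\int[leb n.+2]_x
    F (k0 * thead x + enorm k' * thead [tuple of behead x], dotv x x)%R)%E.
  have swap (G : n.+2.-tuple R -> \bar R) : measurable_fun setT G ->
      (forall x, 0 <= G x)%E ->
      (\int[leb n.+2]_x G x = \int[mu]_t \int[leb n.+1]_y G (vcons (t, y)))%E.
    move=> mG G0; rewrite integral_leb_cons//.
    rewrite (fubini_tonelli (m1 := mu) (m2 := leb n.+1) (fun p => G (vcons p)))//.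
    by apply: (measurableT_comp mG); exact: measurable_vcons.
  rewrite (swap _ mk (fun=> F0 _)) (swap _ mj (fun=> F0 _)).
  apply: eq_integral => t _.
  have mFt : measurable_fun setT (fun p : R * R => F (k0 * t + p.1, t * t + p.2)).
    by apply: (measurableT_comp mF); apply: measurable_fun_pair => /=;
      apply: measurable_funD.
  transitivity (\int[leb n.+1]_y F (k0 * t + dotv k' y, t * t + dotv y y)%R)%E.
    by apply: eq_integral => y _; cbv beta; rewrite !dotv_vcons.
  rewrite (IH k' (fun p => F (k0 * t + p.1, t * t + p.2)))//.
  - by apply: eq_integral => y _; cbv beta; rewrite dotv_vcons behead_vcons.
  - move=> d l a; apply: (measurableT_comp mFt); apply: measurable_fun_pair => /=.
      by apply: measurable_funD => //; exact: measurable_dotvl.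
    exact: measurable_sqnorm.
  - move=> d a; apply: (measurableT_comp mFt); apply: measurable_fun_pair => /=.
      by apply: measurable_funM => //; exact: measurable_thead.
    exact: measurable_sqnorm.
rewrite (integral_leb_cons2 mj (fun=> F0 _)).
rewrite (integral_leb_cons2 (mR _ _) (fun=> F0 _)).
apply: eq_integral => z _.
set rho := enorm (vcons (k0, k')).
have rho2 : rho ^+ 2 = k0 ^+ 2 + enorm k' ^+ 2.
  by rewrite /rho !sqr_enorm dotv_vcons expr2.
have [r0|r0] := eqVneq rho 0.
  have /eqP : k0 ^+ 2 + enorm k' ^+ 2 = 0 by rewrite -rho2 r0 expr0n.
  rewrite paddr_eq0 ?sqr_ge0// !sqrf_eq0 => /andP[/eqP -> /eqP ->].
  apply: eq_integral => t _; apply: eq_integral => u _.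
  by rewrite r0 !mul0r addr0.
have cs : (k0 / rho) ^+ 2 + (enorm k' / rho) ^+ 2 = 1.
  by rewrite !expr_div_n -mulrDl -rho2 divff// sqrf_eq0.
have mH : measurable_fun setT
    (fun p : measurableTypeR R * measurableTypeR R =>
       F (rho * p.1, p.1 ^+ 2 + p.2 ^+ 2 + dotv z z)).
  apply: (measurableT_comp mF); apply: measurable_fun_pair => /=.
    exact: measurable_funM.
  by apply: measurable_funD => //; apply: measurable_funD; exact: measurable_funX.
have := integral_plane_rotation cs mH (fun=> F0 _).
move=> rot.
transitivity (\int[mu]_t \int[mu]_u
    F (rho * t, t ^+ 2 + u ^+ 2 + dotv z z)%R)%E; last first.
  apply: eq_integral => t _; apply: eq_integral => u _.
  by cbv beta; rewrite !dotv_vcons theadE !expr2 addrA.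
rewrite -rot; apply: eq_integral => t _; apply: eq_integral => u _; cbv beta.
rewrite !dotv_vcons !theadE behead_vcons !theadE; congr (F (_, _)).
  by rewrite /=; field.
rewrite /=; move: cs; set c := k0 / rho; set s := enorm k' / rho => cs.
rewrite addrA; congr (_ + _).
transitivity ((c ^+ 2 + s ^+ 2) * (t * t + u * u)); last by ring.
by rewrite cs mul1r.
Qed.

End direction.

(** * Volumes of balls and cubes *)

Section ball_volume.
Context {R : realType}.
Local Notation mu := (@lebesgue_measure R).

Lemma integral_bool d (T : measurableType d) (m : {measure set T -> \bar R})
    (p : T -> bool) : measurable [set x | p x] ->
  (\int[m]_x ((p x)%:R : R)%:E = m [set x | p x])%E.
Proof.
move=> mp; transitivity (\int[m]_x (\1_[set x | p x] x)%:E)%E.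
  by apply: eq_integral => x _; rewrite indicE mem_setE.
by rewrite integral_indic// setIT.
Qed.

Lemma ge0_integralZ d (T : measurableType d) (m : {measure set T -> \bar R})
    (k : R) (f : T -> \bar R) : 0 <= k -> measurable_fun setT f ->
  (forall x, 0 <= f x)%E -> (\int[m]_x (k%:E * f x) = k%:E * \int[m]_x f x)%E.
Proof. by move=> k0 mf f0; rewrite ge0_integralZl. Qed.

Lemma bool_EFin_ge0 (b : bool) : (0 <= (b%:R : R)%:E)%E.
Proof. by rewrite lee_fin. Qed.

Lemma measurable_fun_bool d (T : measurableType d) (p : T -> bool) :
  measurable [set x | p x] -> measurable_fun setT (fun x => (p x)%:R : R).
Proof.
move=> mp; rewrite (_ : (fun x => _) = \1_[set x | p x] :> (T -> R)).
  exact: measurable_indic.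
by apply/funext => x; rewrite indicE mem_setE.
Qed.

Lemma measurable_set_le d (T : measurableType d) (f g : T -> R) :
  measurable_fun setT f -> measurable_fun setT g ->
  measurable [set x | f x <= g x].
Proof.
move=> mf mg; have := measurable_fun_ler mf mg.
by move=> /(_ measurableT [set true] I); rewrite setTI.
Qed.

Lemma measurable_EFin_bool d (T : measurableType d) (p : T -> bool) :
  measurable [set x | p x] -> measurable_fun setT (fun x => ((p x)%:R : R)%:E).
Proof. by move=> mp; apply/measurable_EFinP; exact: measurable_fun_bool. Qed.

Definition cball d (r : R) : set (d.-tuple R) := [set x | enorm x <= r].

Lemma measurable_cball d r : measurable (@cball d r).
Proof. by apply: measurable_set_le => //; exact: measurable_enorm. Qed.

Definition cube d (c : R) : set (d.-tuple R) :=
  [set x | [forall i, `|tnth x i| <= c]].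

Lemma measurable_cube d c : measurable (@cube d c).
Proof.
rewrite (_ : cube c = \bigcap_(i in [set: 'I_d]) [set x | `|tnth x i| <= c]).
  apply: fin_bigcap_measurable; first exact: finite_finset.
  move=> i _; apply: measurable_set_le => //.
  by apply: measurableT_comp => //; exact: measurable_tnth.
by apply/seteqP; split => [x /= /forallP H i _|x H]; [exact: H|apply/forallP => i; exact: H].
Qed.

Lemma leb_cube d (c : R) : 0 <= c -> leb d (cube c) = ((2 * c) ^+ d)%:E.
Proof.
move=> c0; elim: d => [|d IH].
  rewrite /= diracE mem_set ?expr0//=.
  by apply/forallP => -[].
rewrite -integral_bool; last exact: measurable_cube.
have mF : measurable_fun setT
    (fun x : d.+1.-tuple R => ([forall i, `|tnth x i| <= c]%:R : R)%:E).
  by apply: measurable_EFin_bool; exact: measurable_cube.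
rewrite (integral_leb_cons mF); last by move=> x; rewrite lee_fin.
have mt : measurable [set t : measurableTypeR R | `|(t : R)| <= c].
  apply: measurable_set_le => //; exact: normr_measurable.
transitivity (\int[leb d]_y ((2 * c)%:E *
    (([forall i, `|tnth y i| <= c])%:R : R)%:E))%E.
  apply: eq_integral => y _.
  transitivity (\int[mu]_t ((([forall i, `|tnth y i| <= c])%:R : R)%:E *
      ((`|t : R| <= c)%R%:R : R)%:E))%E.
    apply: eq_integral => t _; rewrite -EFinM -natrM mulnb; congr (_%:R%:E).
    congr nat_of_bool; apply/idP/idP => [/forallP H|/andP[/forallP H t1]].
      apply/andP; split; last by have := H ord0.
      by apply/forallP => i; have := H (lift ord0 i); rewrite tnthS.
    by apply/forallP => i; case: (unliftP ord0 i) => [j|] ->; rewrite ?tnthS.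
  rewrite ge0_integralZ//; last exact: measurable_EFin_bool.
  rewrite muleC; congr (_ * _)%E; rewrite integral_bool//.
  transitivity (mu (`[-c, c]%classic : set R)).
    congr (mu _); by apply/seteqP; split => t /=; rewrite in_itv/= ler_norml.
  rewrite lebesgue_measure_itv/= lte_fin.
  have [_|cc] := ltP (- c) c; first by rewrite -EFinB; congr _%:E; ring.
  have -> : c = 0 by lra.
  by rewrite mulr0.
have mC : measurable_fun setT
    (fun y : d.-tuple R => ([forall i, `|tnth y i| <= c]%:R : R)%:E).
  by apply: measurable_EFin_bool; exact: measurable_cube.
rewrite ge0_integralZ// ?mulr_ge0//.
rewrite (integral_bool _ (@measurable_cube d c)).
by rewrite [X in (_ * X)%E]IH -EFinM exprS.
Qed.

Lemma cball_sub_cube d r : @cball d r `<=` cube r.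
Proof.
move=> x /= xr; apply/forallP => i; rewrite (le_trans _ xr)//.
rewrite -sqrtr_sqr ler_wsqrtr// /dotv (bigD1 i)//= -expr2 lerDl.
by apply: sumr_ge0 => j _; rewrite -expr2 sqr_ge0.
Qed.

Lemma cube_sub_cball d r : 0 <= r -> (0 < d)%N ->
  @cube d (r / Num.sqrt d%:R) `<=` cball r.
Proof.
move=> r0 d0 x /forallP H; rewrite /cball/= enorm_le//.
apply: (@le_trans _ _ (\sum_(i < d) (r / Num.sqrt d%:R) ^+ 2)).
  apply: ler_sum => i _; rewrite -expr2 -real_normK ?num_real//.
  by rewrite lerXn2r ?nnegrE// divr_ge0.
rewrite sumr_const card_ord expr_div_n sqr_sqrtr// -[_ *+ d]mulr_natr.
by rewrite divfK// pnatr_eq0 -lt0n.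
Qed.

Definition omega d : R := fine (leb d (cball 1)).

Lemma leb_cball_fin d r : leb d (@cball d r) \is a fin_num.
Proof.
rewrite ge0_fin_numE//; have [r0|r0] := leP 0 r; last first.
  rewrite (_ : cball r = set0) ?measure0//.
  by apply/seteqP; split => // x; rewrite /cball/= leNgt (lt_le_trans r0)// enorm_ge0.
apply: (@le_lt_trans _ _ (leb d (cube r))); last by rewrite leb_cube// ltry.
apply: le_measure; rewrite ?inE; [exact: measurable_cball|exact: measurable_cube|].
exact: cball_sub_cube.
Qed.

Lemma enormZ d a (x : d.-tuple R) : enorm (vaff a (vzero) x) = `|a| * enorm x.
Proof.
rewrite /enorm -sqrtr_sqr -sqrtrM ?sqr_ge0//; congr Num.sqrt.
rewrite /dotv mulr_sumr; apply: eq_bigr => i _; rewrite !tnth_mktuple; ring.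
Qed.

(** Homogeneity, by the substitution that dilates the unit ball. *)
Lemma leb_cball d r : 0 < r -> leb d (cball r) = (omega d * r ^+ d)%:E.
Proof.
move=> r0; rewrite EFinM /omega fineK ?leb_cball_fin//.
rewrite -!integral_bool; [|exact: measurable_cball..].
have m1 : measurable_fun setT (fun x : d.-tuple R => ((enorm x <= r)%R%:R : R)%:E).
  by apply: measurable_EFin_bool; exact: measurable_cball.
have := @ge0_integral_vaff _ d r vzero _ (lt0r_neq0 r0) m1 (fun=> bool_EFin_ge0 _).
have -> : (\int[leb d]_x ((enorm (vaff r vzero x) <= r)%R%:R : R)%:E =
           \int[leb d]_x ((enorm x <= 1)%R%:R : R)%:E)%E.
  apply: eq_integral => x _; congr (nat_of_bool _)%:R%:E.
  by rewrite enormZ gtr0_norm// -ler_pdivlMl// mulVf ?gt_eqF.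
move=> ->; rewrite muleAC -EFinM gtr0_norm// mulVf ?mul1e// expf_neq0//.
exact: lt0r_neq0.
Qed.

(** The cube inscribed in the unit ball; this is what bounds the radius of a
    ball of volume V by a multiple of the square root of the dimension. *)
Lemma omega_ge d : (0 < d)%N -> (2 / Num.sqrt d%:R) ^+ d <= omega d.
Proof.
move=> d0; rewrite -lee_fin fineK ?leb_cball_fin//.
have := @cube_sub_cball d 1 ler01 d0; rewrite mul1r => sub.
rewrite -leb_cube; last by rewrite invr_ge0.
by apply: le_measure; rewrite ?inE//; [exact: measurable_cube|exact: measurable_cball].
Qed.

Lemma omega_gt0 d : (0 < d)%N -> 0 < omega d.
Proof.
move=> d0; apply: lt_le_trans (omega_ge d0); apply: exprn_gt0.
by rewrite divr_gt0// sqrtr_gt0 ltr0n.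
Qed.

End ball_volume.

(** * The unit ball and the Gamma function *)

Section gaussian.
Context {R : realType}.
Local Notation mu := (@lebesgue_measure R).

Lemma integral_gauss_leb d :
  (\int[leb d]_x (expR (- dotv x x))%:E = (Num.sqrt pi ^+ d : R)%:E)%E.
Proof.
have mE n : measurable_fun setT (fun x : n.-tuple R => (expR (- dotv x x))%:E).
  apply/measurable_EFinP; apply: measurableT_comp => //.
  by apply: measurableT_comp => //; exact: measurable_sqnorm.
elim: d => [|d IH].
  transitivity (\int[leb 0]_(x in setT) (cst (1%:E) x : \bar R))%E.
    apply: eq_integral => x _; rewrite /dotv big_ord0 oppr0 expR0//.
  by rewrite integral_cst//= mul1e diracE mem_set.
rewrite (integral_leb_cons (mE _)); last by move=> x; rewrite lee_fin expR_ge0.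
transitivity (\int[leb d]_y ((Num.sqrt (@pi R))%:E * (expR (- dotv y y))%:E))%E.
  apply: eq_integral => y _.
  transitivity (\int[mu]_t ((expR (- dotv y y))%:E * (gauss_fun t)%:E))%E.
    apply: eq_integral => t _; rewrite dotv_vcons opprD expRD EFinM muleC.
    by rewrite -expr2.
  rewrite ge0_integralZ ?expR_ge0//.
  - by rewrite integralT_gauss muleC.
  - by apply/measurable_EFinP; exact: measurable_gauss_fun.
  - by move=> t; exact: gauss_fun_ge0.
rewrite ge0_integralZ ?sqrtr_ge0//; first by rewrite IH -EFinM exprS.
exact: mE.
Qed.

Lemma integral_expR_tail (q : R) :
  (\int[mu]_(s in `[q, +oo[) (expR (- s))%:E = (expR (- q))%:E)%E.
Proof.
have dN : forall x : R, derivable (-%R : R -> R) x 1 by move=> x; exact: derivable_opp.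
have dE (x : R) : is_derive x 1 (fun s : R => - expR (- s)) (expR (- x)).
  by apply: is_derive_eq; rewrite mulrN1 opprK.
have cE : continuous (fun s : R => expR (- s)).
  by move=> x; apply: continuous_comp; [exact: opp_continuous|exact: continuous_expR].
rewrite (@ge0_continuous_FTC2y _ _ (fun s => - expR (- s)) _ 0).
- by rewrite EFinN oppeK add0e.
- by move=> x _; rewrite expR_ge0.
- exact: continuous_subspaceT.
- rewrite -oppr0; apply: cvgN; exact: cvgr_expR.
- by move=> x _; exact: ex_derive.
- by apply: cvg_at_right_filter; apply: cvgN; exact: cE.
- by move=> x _; rewrite derive1E derive_val.
Qed.

(** The levels are restricted to the positive half-line, the domain of
    integration in [Gamma]; for [q = 0] this drops the level 0 only. *)
Lemma expR_layer_cake (q : R) : 0 <= q ->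
  ((expR (- q))%:E =
   \int[mu]_s (((0 < s) && (q <= s))%R%:R * expR (- s))%R%:E)%E.
Proof.
move=> q0.
have mE (D : set R) : measurable_fun D (fun s : R => (expR (- s))%:E).
  apply/measurable_EFinP/measurable_funTS; apply: measurableT_comp => //.
transitivity (\int[mu]_(s in [set s : R | (0 < s) && (q <= s)]%R)
   (expR (- s))%:E)%E; last first.
  rewrite integral_mkcond; apply: eq_integral => s _.
  rewrite patchE; case: ifPn; rewrite ?inE ?notin_setE /= => h.
    by rewrite h mul1r.
  by move/negP/negbTE : h => ->; rewrite mul0r.
have [q0'|q0'] := eqVneq q 0.
  rewrite (_ : [set s | _] = `]0, +oo[%classic); last first.
    apply/seteqP; split => s /=; rewrite in_itv/= andbT q0'; first by case/andP.
    by move=> s0; rewrite s0 ltW.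
  by rewrite integral_itv_obnd_cbnd// q0' integral_expR_tail.
rewrite (_ : [set s | _] = `[q, +oo[%classic); first by rewrite integral_expR_tail.
apply/seteqP; split => s /=; rewrite in_itv/= andbT; first by case/andP.
by move=> qs; rewrite qs andbT (lt_le_trans _ qs)// lt_neqAle eq_sym q0'.
Qed.

(** Integrating the Gaussian over its superlevel sets, which are balls, gives
    the volume of the unit ball in terms of the Gamma function. *)
Lemma omega_Gamma d : (0 < d)%N ->
  omega d * Gamma (d%:R / 2 + 1) = Num.sqrt pi ^+ d :> R.
Proof.
move=> d0.
pose G (p : d.-tuple R * measurableTypeR R) : \bar R :=
  (((0 < p.2) && (dotv p.1 p.1 <= p.2))%R%:R * expR (- p.2))%:E.
have mG : measurable_fun setT G.
  apply/measurable_EFinP; apply: measurable_funM.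
    apply: measurable_fun_bool.
    rewrite (_ : [set x | _] =
        [set p : d.-tuple R * measurableTypeR R | 0 < p.2] `&`
        [set p | dotv p.1 p.1 <= p.2]); last first.
      by apply/seteqP; split => p /=; [case/andP|case => -> ->].
    apply: measurableI.
      rewrite (_ : [set x | _] = ~` [set p : d.-tuple R * measurableTypeR R | p.2 <= 0]).
        by apply: measurableC; apply: measurable_set_le.
      by apply/seteqP; split => p /=; rewrite ltNge => /negP.
    apply: measurable_set_le => //.
    by apply: (measurableT_comp (@measurable_sqnorm R d)).
  apply: measurableT_comp => //; exact: measurableT_comp.
have G0 p : (0 <= G p)%E by rewrite lee_fin mulr_ge0// expR_ge0.
have := integral_gauss_leb d.
rewrite (_ : (\int[leb d]_x _ = \int[leb d]_x \int[mu]_s G (x, s))%E); last first.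
  by apply: eq_integral => x _; exact: (expR_layer_cake (dotv_ge0 x)).
rewrite (fubini_tonelli (m1 := leb d) (m2 := mu) _ mG G0).
pose g (s : R) : R := s `^ (d%:R / 2 + 1 - 1) * expR (- s).
have mg : measurable_fun setT g.
  apply: measurable_funM; first exact: measurable_powR.
  by apply: measurableT_comp.
have g0 s : 0 <= g s by rewrite mulr_ge0 ?powR_ge0 ?expR_ge0.
rewrite (_ : (\int[mu]_s _ = (omega d)%:E * \int[mu]_(s in `]0%R, +oo[) (g s)%:E)%E); last first.
  rewrite [in RHS]integral_mkcond -ge0_integralZ.
  - apply: eq_integral => s _; rewrite patchE; case: ifPn => s0.
      have {}s0 : 0 < s by move: s0; rewrite inE/= in_itv/= andbT.
      transitivity (\int[leb d]_x ((expR (- s))%:E * ((enorm x <= Num.sqrt s)%R%:R : R)%:E))%E.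
        apply: eq_integral => x _; rewrite /G/= s0/= enorm_le ?sqrtr_ge0// sqr_sqrtr ?(ltW s0)//.
        by rewrite -EFinM mulrC.
      have mb : measurable_fun setT
          (fun x : d.-tuple R => ((enorm x <= Num.sqrt s)%R%:R : R)%:E).
        by apply: measurable_EFin_bool; exact: measurable_cball.
      rewrite (ge0_integralZ (leb d) (expR_ge0 (- s : R)) mb); last first.
        by move=> x; exact: bool_EFin_ge0.
      rewrite integral_bool; last exact: measurable_cball.
      rewrite [X in (_ * X)%E](leb_cball _ _) ?sqrtr_gt0// -!EFinM; congr _%:E.
      have e : Num.sqrt s ^+ d = s `^ (d%:R / 2).
        rewrite -powR12_sqrt ?(ltW s0)// -powR_mulrn ?powR_ge0// -powRrM.
        by rewrite mulrC.
      by rewrite /g addrK e; ring.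
    rewrite mule0; apply: integral0_eq => x _; rewrite /G/=.
    have : ~~ (0 < s) by move: s0; rewrite notin_setE/= in_itv/= andbT => /negP.
    by move=> /negbTE ->; rewrite /= mul0r.
  - by rewrite ltW// omega_gt0.
  - apply/(measurable_restrictT _ _).1 => //; apply: measurable_funTS.
    by apply/measurable_EFinP; exact: mg.
  - by move=> s; rewrite patchE; case: ifPn => // _; rewrite lee_fin.
rewrite /Gamma /Rintegral -/g.
have : (0 <= \int[mu]_(s in `]0%R, +oo[) (g s)%:E)%E.
  by apply: integral_ge0 => s _; rewrite lee_fin.
case: (\int[mu]_(s in `]0%R, +oo[) (g s)%:E)%E => [r|//|//] r0.
- by rewrite -EFinM => -[].
- by rewrite gt0_muley ?lte_fin ?omega_gt0.
Qed.

End gaussian.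

(** * The cosine on an interval *)

Section sinc.
Context {R : realType}.
Local Notation mu := (@lebesgue_measure R).
Implicit Types x u : R.

Lemma derive_ge0_ge0 (f f' : R -> R) x : (forall y : R, is_derive y 1 f (f' y)) ->
  (forall y : R, 0 <= y -> 0 <= f' y) -> f 0 = 0 -> 0 <= x -> 0 <= f x.
Proof.
move=> df f'0 f0; rewrite le_eqVlt => /predU1P[<-|x0]; first by rewrite f0.
have cf : {within `[0, x], continuous f}.
  apply: continuous_subspaceT => y; apply: differentiable_continuous.
  apply/derivable1_diffP; exact: ex_derive.
have [c cx fc] := MVT x0 (fun y _ => df y) cf.
move: fc; rewrite f0 !subr0 => ->; rewrite mulr_ge0//; last exact: ltW.
by apply: f'0; rewrite ltW//; move: cx; rewrite in_itv/= => /andP[].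
Qed.

Lemma sin_le_id x : 0 <= x -> sin x <= x.
Proof.
move=> x0; rewrite -subr_ge0.
apply: (@derive_ge0_ge0 (fun y => y - sin y) (fun y => 1 - cos y)) => //.
by rewrite sin0 subrr.
Qed.

Lemma normr_sin_le x : `|sin x| <= `|x|.
Proof.
wlog x0 : x / 0 <= x => [H|].
  by have [/H//|/ltW x0] := leP 0 x; rewrite -normrN -sinN -[leRHS]normrN H// oppr_ge0.
rewrite (ger0_norm x0) ler_norml sin_le_id// andbT.
have [x1|x1] := leP 1 x.
  by rewrite (le_trans _ (sin_geN1 x))// lerN2.
have s0 : 0 <= sin x.
  by apply: sin_ge0_pi; rewrite x0/= (le_trans (ltW x1))// (le_trans _ (@pi_ge2 R))// ler1n.
by rewrite (le_trans _ s0)// oppr_le0.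
Qed.

(** Half-angle form, which turns bounds on the sine into bounds on the cosine. *)
Lemma cosE_half x : cos x = 1 - 2 * sin (x / 2) ^+ 2.
Proof. by rewrite {1}[x](splitr x) cosD -!expr2 cos2sin2; ring. Qed.

Lemma cos_ge x : 1 - x ^+ 2 / 2 <= cos x.
Proof.
have h : sin (x / 2) ^+ 2 <= (x / 2) ^+ 2.
  rewrite -[leLHS]real_normK ?num_real// -[leRHS]real_normK ?num_real//.
  by rewrite lerXn2r ?nnegrE// normr_sin_le.
by rewrite cosE_half; move: h; rewrite expr_div_n; lra.
Qed.

Lemma sin_ge x : 0 <= x -> x - x ^+ 3 / 6 <= sin x.
Proof.
move=> x0; rewrite -subr_ge0.
apply: (@derive_ge0_ge0 (fun y => sin y - (y - y ^+ 3 / 6))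
  (fun y => cos y - (1 - y ^+ 2 / 2))) => //.
- by move=> y; apply: is_derive_eq; rewrite /GRing.scale/=; field.
- by move=> y _; rewrite subr_ge0 cos_ge.
- by rewrite sin0 expr0n/= mul0r !subr0.
Qed.

(** The relative deficit in [|sin u| <= u], quadratic near the origin and bounded below
    at infinity. *)
Lemma sinc_bound u : 0 <= u ->
  `|sin u| <= u * (1 - Num.min (1 / 2) (u ^+ 2 / 10)).
Proof.
move=> u0; have [u2|u2] := leP 2 u.
  rewrite (le_trans (sin_max u))//.
  have : Num.min (1 / 2) (u ^+ 2 / 10) <= 1 / 2 by rewrite ge_min lexx.
  nra.
have sin_ge0 : 0 <= sin u.
  by apply: sin_ge0_pi; rewrite u0/= (le_trans (ltW u2))// pi_ge2.
rewrite ger0_norm//.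
apply: (@le_trans _ _ (u * (1 - u ^+ 2 / 10))); last first.
  by rewrite ler_wpM2l// lerD2l lerN2 ge_min lexx orbT.
have -> : sin u = 2 * (sin (u / 2) * cos (u / 2)).
  by rewrite {1}[u](splitr u) sinD; ring.
have [s1 s2 s3] : [/\ 0 <= sin (u / 2), sin (u / 2) <= u / 2 &
    u / 4 * (23 / 24) <= sin (u / 4)].
  split.
  - by apply: sin_ge0_pi; have := @pi_ge2 R; lra.
  - by apply: sin_le_id; lra.
  - have := @sin_ge (u / 4); nra.
have -> : cos (u / 2) = 1 - 2 * sin (u / 4) ^+ 2.
  by rewrite cosE_half -mulrA -invfM -natrM.
have : (u / 4 * (23 / 24)) ^+ 2 <= sin (u / 4) ^+ 2 by rewrite lerXn2r ?nnegrE//; lra.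
have : 0 <= 1 - 2 * sin (u / 4) ^+ 2.
  by have := cos_ge (u / 2); rewrite cosE_half -mulrA -invfM -natrM; nra.
set c := _ - _ => c0 h.
have h' : c <= 1 - u ^+ 2 / 10.
  have u2_ge0 := sqr_ge0 u.
  have e : (u / 4 * (23 / 24)) ^+ 2 = u ^+ 2 * (529 / 9216) by field.
  by rewrite /c; move: h; rewrite e; lra.
nra.
Qed.

Lemma integral_1cos (a k s : R) : 0 < k -> 0 < s ->
  (\int[mu]_(t in `[(- s)%R, s]) (1 + a * cos (k * t))%:E =
   (2 * s + a * (2 * sin (k * s) / k))%:E)%E.
Proof.
move=> k0 s0; have ss : - s < s by lra.
have dF (x : R) : is_derive x 1 (fun t => t + a / k * sin (k * t)) (1 + a * cos (k * x)).
  apply: is_derive_eq; rewrite /GRing.scale/=; field. exact: lt0r_neq0.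
have cF : continuous (fun t => t + a / k * sin (k * t)).
  by move=> x; apply: differentiable_continuous; apply/derivable1_diffP; exact: ex_derive.
rewrite (@continuous_FTC2 _ _ (fun t => t + a / k * sin (k * t)))//.
- by rewrite -EFinB mulrN sinN; congr _%:E; field; exact: lt0r_neq0.
- apply: continuous_subspaceT => x; apply: cvgD; first exact: cvg_cst.
  apply: cvgM; first exact: cvg_cst.
  apply: continuous_comp; last exact: continuous_cos.
  by apply: cvgM; [exact: cvg_cst|exact: cvg_id].
- split => [x _| |]; first exact: ex_derive.
    by apply: cvg_at_right_filter; exact: cF.
  by apply: cvg_at_left_filter; exact: cF.
- by move=> x _; rewrite derive1E derive_val.
Qed.

Lemma integral_1cos_ge (a k s m : R) : `|a| <= 1 -> 0 < k -> 0 < s ->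
  m <= Num.min (1 / 2) ((k * s) ^+ 2 / 10) ->
  ((2 * s * m)%:E <= \int[mu]_(t in `[(- s)%R, s]) (1 + a * cos (k * t))%:E)%E.
Proof.
move=> a1 k0 s0 hm; rewrite integral_1cos// lee_fin.
have ks : 0 < k * s by rewrite mulr_gt0.
have := sinc_bound (ltW ks); set M := Num.min _ _ in hm *.
move=> hs; have h : `|a * sin (k * s)| <= k * s * (1 - M).
  rewrite normrM (le_trans _ hs)// -[leRHS]mul1r ler_wpM2r//.
have : - (k * s * (1 - M)) / k <= a * sin (k * s) / k.
  rewrite ler_pM2r ?invr_gt0//; by move: h; rewrite ler_norml => /andP[].
have -> : - (k * s * (1 - M)) / k = - s * (1 - M) by field; exact: lt0r_neq0.
have -> : a * (2 * sin (k * s) / k) = 2 * (a * sin (k * s) / k) by ring.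
nra.
Qed.

End sinc.

(** * Averages of trigonometric weights over a ball *)

Section ball_averages.
Context {R : realType}.
Local Notation mu := (@lebesgue_measure R).

Lemma measurable_fun_le d (T : measurableType d) (f g : T -> R) :
  measurable_fun setT f -> measurable_fun setT g ->
  measurable_fun setT (fun x => (f x <= g x)%R%:R : R).
Proof. by move=> mf mg; apply: measurable_fun_bool; exact: measurable_set_le. Qed.

Lemma cos_weight_ge0 (a x : R) : `|a| <= 1 -> 0 <= 1 + a * cos x.
Proof.
move=> a1; have : `|a * cos x| <= 1.
  by rewrite normrM -[leRHS]mulr1 ler_pM// cos_max.
by rewrite ler_norml => /andP[]; lra.
Qed.

Lemma measurable_cos : measurable_fun setT (@cos R).
Proof. by apply: continuous_measurable_fun; exact: continuous_cos. Qed.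

(** The contribution of the chord at squared distance [q] from the axis.  If
    its half-length is at least [sg], then [integral_1cos_ge] applies; if not, the
    parallel chord of the ball of squared radius [r ^+ 2 - sg ^+ 2] is empty. *)
Lemma integral_chord (a k r q m sg : R) : `|a| <= 1 -> 0 < k -> 0 < sg -> 0 <= m ->
  m <= Num.min (1 / 2) ((k * sg) ^+ 2 / 10) ->
  (\int[mu]_t (m * (t * t + q <= r ^+ 2 - sg ^+ 2)%R%:R)%:E <=
   \int[mu]_t ((1 + a * cos (k * t)) * (t * t + q <= r ^+ 2)%R%:R)%:E)%E.
Proof.
move=> a1 k0 sg0 m0 hm.
have mq (c : R) : measurable_fun setT (fun t : R => (t * t + q <= c)%R%:R : R).
  by apply: measurable_fun_le => //; apply: measurable_funD => //; exact: measurable_funM.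
have mcos : measurable_fun setT (fun t : R => 1 + a * cos (k * t)).
  apply: measurable_funD => //; apply: measurable_funM => //.
  by apply: (measurableT_comp measurable_cos); exact: measurable_funM.
have [qr|qr] := leP q (r ^+ 2 - sg ^+ 2); last first.
  rewrite integral0_eq => [|t _]; last first.
    have -> : (t * t + q <= r ^+ 2 - sg ^+ 2) = false.
      by apply/negbTE; rewrite -ltNge (lt_le_trans qr)// lerDr -expr2 sqr_ge0.
    by rewrite mulr0.
  by apply: integral_ge0 => t _; rewrite lee_fin mulr_ge0// cos_weight_ge0.
pose s := Num.sqrt (r ^+ 2 - q).
have s2 : s ^+ 2 = r ^+ 2 - q by rewrite sqr_sqrtr//; have := sqr_ge0 sg; lra.
have sgs : sg <= s.
  by rewrite -[sg]gtr0_norm// -sqrtr_sqr ler_wsqrtr//; lra.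
have s0 : 0 < s by exact: lt_le_trans sgs.
have tE t : (t * t + q <= r ^+ 2) = (t \in `[(- s), s]).
  rewrite in_itv/= -ler_norml -lerBrDr -s2 -expr2 -real_normK ?num_real//.
  by rewrite ler_sqr ?nnegrE// ltW.
apply: (@le_trans _ _ (2 * s * m)%:E).
  apply: (@le_trans _ _ (\int[mu]_t (m%:E * (\1_(`[(- s), s]%classic) t)%:E))%E).
    apply: ge0_le_integral => //.
    - by move=> t _; rewrite lee_fin mulr_ge0.
    - by apply/measurable_EFinP; apply: measurable_funM => //; exact: mq.
    - by apply/measurable_EFinP; apply: measurable_funM => //; exact: measurable_indic.
    - move=> t _; rewrite -EFinM lee_fin ler_wpM2l// indicE mem_setE -tE.
      case: (leP _ (r ^+ 2 - sg ^+ 2)) => // h.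
      by rewrite (le_trans h)// lerBlDr lerDl sqr_ge0.
  rewrite ge0_integralZ//; last by apply/measurable_EFinP; exact: measurable_indic.
  rewrite integral_indic// setIT.
  rewrite [X in (_ * X)%E](_ : _ = (2 * s)%:E); last first.
    transitivity (mu (`[(- s), s]%classic : set R)); first by [].
    rewrite lebesgue_measure_itv/= lte_fin ifT; last by lra.
    by rewrite -EFinB; congr _%:E; ring.
  by rewrite -EFinM lee_fin; lra.
have m' : m <= Num.min (1 / 2) ((k * s) ^+ 2 / 10).
  rewrite (le_trans hm)// le_min ge_min lexx/= ge_min ler_pM2r// !exprMn.
  by rewrite [X in _ || X]ler_wpM2l ?sqr_ge0 ?orbT// lerXn2r ?nnegrE// ltW.
rewrite (le_trans (integral_1cos_ge a1 k0 s0 m'))//.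
rewrite integral_mkcond; apply: ge0_le_integral => //.
- move=> t _; rewrite patchE; case: ifPn => // _; rewrite lee_fin cos_weight_ge0//.
- by apply/(measurable_restrictT _ _).1 => //; apply: measurable_funTS; exact/measurable_EFinP.
- by apply/measurable_EFinP; apply: measurable_funM => //; exact: mq.
- move=> t _; rewrite patchE tE; case: ifPn => h.
    have -> : t \in `[(- s), s] by move: h; rewrite inE.
    by rewrite mulr1.
  by rewrite (_ : point = 0%E)// lee_fin mulr_ge0// cos_weight_ge0.
Qed.

End ball_averages.

Section ball_averages_vec.
Context {R : realType}.
Local Notation mu := (@lebesgue_measure R).

Lemma cosball_ge_shrunk n (k : n.+1.-tuple R) (a r m sg : R) :
  `|a| <= 1 -> 0 < enorm k -> 0 < sg -> sg <= r -> 0 <= m ->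
  m <= Num.min (1 / 2) ((enorm k * sg) ^+ 2 / 10) ->
  (m%:E * leb n.+1 (cball (Num.sqrt (r ^+ 2 - sg ^+ 2))) <=
   \int[leb n.+1]_x ((1 + a * cos (dotv k x)) * (enorm x <= r)%R%:R)%:E)%E.
Proof.
move=> a1 k0 sg0 sgr m0 hm.
have r0 : 0 <= r by rewrite (le_trans _ sgr)// ltW.
have rs0 : 0 <= r ^+ 2 - sg ^+ 2.
  by rewrite subr_ge0 lerXn2r// ?nnegrE// ltW.
pose F (p : R * R) : \bar R := ((1 + a * cos p.1) * (p.2 <= r ^+ 2)%R%:R)%:E.
have mF : measurable_fun setT F.
  apply/measurable_EFinP; apply: measurable_funM.
    apply: measurable_funD => //; apply: measurable_funM => //.
    by apply: (measurableT_comp measurable_cos).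
  by apply: measurable_fun_le.
have F0 p : (0 <= F p)%E by rewrite lee_fin mulr_ge0// cos_weight_ge0.
rewrite (_ : (\int[leb n.+1]_x _ = \int[leb n.+1]_x F (dotv k x, dotv x x))%E); last first.
  by apply: eq_integral => x _; rewrite /F/= enorm_le.
rewrite (integral_leb_direction k mF F0).
have mb d : measurable_fun setT (fun x : d.-tuple R =>
    (m * (dotv x x <= r ^+ 2 - sg ^+ 2)%R%:R)%:E).
  apply/measurable_EFinP; apply: measurable_funM => //.
  by apply: measurable_fun_le => //; exact: measurable_sqnorm.
have -> : (m%:E * leb n.+1 (cball (Num.sqrt (r ^+ 2 - sg ^+ 2))) =
    \int[leb n.+1]_x (m * (dotv x x <= r ^+ 2 - sg ^+ 2)%R%:R)%:E)%E.
  rewrite -integral_bool; last exact: measurable_cball.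
  rewrite -ge0_integralZ//; last first.
    by apply: measurable_EFin_bool; exact: measurable_cball.
  apply: eq_integral => x _; rewrite -EFinM.
  by rewrite enorm_le ?sqrtr_ge0// sqr_sqrtr.
have mFk : measurable_fun setT (fun x : n.+1.-tuple R => F (enorm k * thead x, dotv x x)).
  apply: (measurableT_comp mF); apply: measurable_fun_pair => /=.
    by apply: measurable_funM => //; exact: measurable_thead.
  exact: measurable_sqnorm.
have b0 d (x : d.-tuple R) : (0 <= (m * (dotv x x <= r ^+ 2 - sg ^+ 2)%R%:R)%:E)%E.
  by rewrite lee_fin mulr_ge0.
rewrite (integral_leb_cons (mb _) (b0 _)) (integral_leb_cons mFk (fun=> F0 _)).
apply: ge0_le_integral => //.
- by move=> y _; exact: integral_ge0.
- apply: (measurable_fun_fubini_tonelli_G (m1 := mu)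
    (fun p : measurableTypeR R * n.-tuple R => (m * (dotv (vcons p) (vcons p) <= r ^+ 2 - sg ^+ 2)%R%:R)%:E)) => //.
  exact: (measurableT_comp (mb _) (@measurable_vcons R n)).
- apply: (measurable_fun_fubini_tonelli_G (m1 := mu)
    (fun p : measurableTypeR R * n.-tuple R => F (enorm k * thead (vcons p), dotv (vcons p) (vcons p)))) => //.
  exact: (measurableT_comp mFk (@measurable_vcons R n)).
move=> y _.
have := @integral_chord _ a (enorm k) r (dotv y y) m sg a1 k0 sg0 m0 hm.
congr (_ <= _)%E; apply: eq_integral => t _; rewrite dotv_vcons//.
Qed.

(** The weights 1 + cos and 1 - cos keep a fixed proportion of the ball: by
    slicing along [k], each chord of half-length at least [r / sqrt (2 d)]
    contributes, and those chords cover at least half of the volume because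
    they contain the ball of radius [r * sqrt (1 - 1 / (2 d))]. *)
Lemma cosball_ge n (k : n.+1.-tuple R) (a r : R) : `|a| <= 1 -> 0 < r ->
  ((omega n.+1 * r ^+ n.+1 *
    Num.min (1 / 4) (enorm k ^+ 2 * r ^+ 2 / (40 * n.+1%:R)))%:E <=
   \int[leb n.+1]_x ((1 + a * cos (dotv k x)) * (enorm x <= r)%R%:R)%:E)%E.
Proof.
move=> a1 r0.
have [k0|k0] := eqVneq (enorm k) 0.
  rewrite k0 expr0n/= !mul0r (_ : Num.min _ 0 = 0) ?mulr0; last first.
    by apply/min_idPr; lra.
  by apply: integral_ge0 => x _; rewrite lee_fin mulr_ge0// cos_weight_ge0.
have {}k0 : 0 < enorm k by rewrite lt_neqAle eq_sym k0 enorm_ge0.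
set d : R := n.+1%:R; have d1 : 1 <= d by rewrite ler1n.
have d0 : 0 < d by lra.
pose sg := r / Num.sqrt (2 * d).
have sq0 : 0 < Num.sqrt (2 * d) by rewrite sqrtr_gt0; lra.
have sg0 : 0 < sg by rewrite divr_gt0.
have sg2 : sg ^+ 2 = r ^+ 2 / (2 * d) by rewrite expr_div_n sqr_sqrtr//; lra.
have lam0 : 0 < 1 - 1 / (2 * d).
  by rewrite subr_gt0 ltr_pdivrMr; lra.
pose lam := Num.sqrt (1 - 1 / (2 * d)).
have sq1 : 1 <= Num.sqrt (2 * d).
  by rewrite -[leLHS]sqrtr1 ler_wsqrtr//; lra.
have sgr : sg <= r by rewrite ler_pdivrMr//; nra.
set M := Num.min _ _.
have M0 : 0 <= M.
  rewrite le_min; apply/andP; split; first lra.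
  by rewrite divr_ge0 ?mulr_ge0 ?sqr_ge0//; lra.
have hM : 2 * M <= Num.min (1 / 2) ((enorm k * sg) ^+ 2 / 10).
  have M1 : M <= 1 / 4 by rewrite ge_min lexx.
  have M2 : M <= enorm k ^+ 2 * r ^+ 2 / (40 * d) by rewrite ge_min lexx orbT.
  rewrite le_min; apply/andP; split; first lra.
  rewrite exprMn sg2; apply: (le_trans (ler_wpM2l _ M2)) => //.
  rewrite le_eqVlt; apply/orP; left; apply/eqP; field; lra.
have M20 : 0 <= 2 * M by lra.
apply: le_trans (cosball_ge_shrunk a1 k0 sg0 sgr M20 hM).
have -> : r ^+ 2 - sg ^+ 2 = (lam * r) ^+ 2.
  by rewrite sg2 exprMn sqr_sqrtr ?(ltW lam0)//; field; lra.
rewrite sqrtr_sqr ger0_norm ?mulr_ge0 ?sqrtr_ge0 ?(ltW r0)//.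
rewrite leb_cball ?mulr_gt0 ?sqrtr_gt0// -EFinM lee_fin exprMn.
have lamn : 1 / 2 <= lam ^+ n.+1.
  have lam1 : lam <= 1 by rewrite -[leRHS]sqrtr1 ler_wsqrtr// gerBl divr_ge0//; lra.
  (* As [lam <= 1], squaring only decreases the power and removes the root. *)
  apply: (@le_trans _ _ (lam ^+ n.+1 ^+ 2)); last first.
    rewrite expr2 ler_piMr ?exprn_ge0 ?sqrtr_ge0// exprn_ile1// sqrtr_ge0//.
  rewrite -exprM mulnC exprM sqr_sqrtr ?(ltW lam0)//.
  (* Bernoulli's inequality gives (1 - 1 / (2 d)) ^ d >= 1 / 2. *)
  have bern m (x : R) : 0 <= x -> x <= 1 -> 1 - m%:R * x <= (1 - x) ^+ m.
    move=> x0 x1; elim: m => [|m IH]; first by rewrite mul0r subr0 expr0.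
    rewrite exprS; apply: (@le_trans _ _ ((1 - x) * (1 - m%:R * x))).
      rewrite -[m.+1]addn1 natrD; have : 0 <= (m%:R : R) by [].
      nra.
    by rewrite ler_wpM2l// subr_ge0.
  apply: le_trans (bern _ _ _ _); last 2 first.
  - by rewrite divr_ge0//; lra.
  - by rewrite ler_pdivrMr; lra.
  by rewrite -/d le_eqVlt; apply/orP; left; apply/eqP; field; lra.
have om := @omega_gt0 R n.+1 isT.
have P0 : 0 <= omega n.+1 * r ^+ n.+1 * M.
  by rewrite mulr_ge0// mulr_ge0 ?exprn_ge0 ?ltW.
rewrite (_ : 2 * M * _ = omega n.+1 * r ^+ n.+1 * M * (2 * lam ^+ n.+1)); last by ring.
by rewrite ler_peMr//; lra.
Qed.

Definition axis d (i : 'I_d) : d.-tuple R := [tuple (j == i)%:R | j < d].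

Lemma dotv_axis d (i : 'I_d) x : dotv (axis i) x = tnth x i.
Proof.
rewrite /dotv (bigD1 i)//= tnth_mktuple eqxx mul1r big1 ?addr0// => j ji.
by rewrite tnth_mktuple (negbTE ji) mul0r.
Qed.

Lemma enorm_axis d (i : 'I_d) : enorm (axis i) = 1.
Proof. by rewrite /enorm dotv_axis tnth_mktuple eqxx sqrtr1. Qed.

(** All directions have the same second moment over the ball, and those of the
    coordinate axes add up to the integral of the squared norm. *)
Lemma ball_second_moment n (k : n.+1.-tuple R) (r : R) : 0 < r ->
  (\int[leb n.+1]_x (dotv k x ^+ 2 * (enorm x <= r)%R%:R)%:E <=
   (enorm k ^+ 2 * r ^+ 2 / n.+1%:R * (omega n.+1 * r ^+ n.+1))%:E)%E.
Proof.
move=> r0.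
pose F (p : R * R) : \bar R := (p.1 ^+ 2 * (p.2 <= r ^+ 2)%R%:R)%:E.
have mF : measurable_fun setT F.
  apply/measurable_EFinP; apply: measurable_funM; first exact: measurable_funX.
  exact: measurable_fun_le.
have F0 p : (0 <= F p)%E by rewrite lee_fin mulr_ge0// sqr_ge0.
have FE l : (\int[leb n.+1]_x (dotv l x ^+ 2 * (enorm x <= r)%R%:R)%:E =
    \int[leb n.+1]_x F (dotv l x, dotv x x))%E.
  by apply: eq_integral => x _; rewrite /F/= enorm_le// ltW.
pose M1 := (\int[leb n.+1]_x F (thead x, dotv x x))%E.
have M10 : (0 <= M1)%E by exact: integral_ge0.
have mM1 : measurable_fun setT (fun x : n.+1.-tuple R => F (thead x, dotv x x)).
  apply: (measurableT_comp mF); apply: measurable_fun_pair => /=.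
    exact: measurable_thead.
  exact: measurable_sqnorm.
have dirE l : (\int[leb n.+1]_x F (dotv l x, dotv x x) = (enorm l ^+ 2)%:E * M1)%E.
  rewrite (integral_leb_direction l mF F0) -ge0_integralZ ?sqr_ge0//.
  by apply: eq_integral => x _; rewrite /F/= -EFinM exprMn -mulrA.
have sumE : (n.+1%:R%:E * M1 <= (r ^+ 2 * (omega n.+1 * r ^+ n.+1))%:E)%E.
  have -> : (n.+1%:R%:E * M1 = \sum_(i < n.+1) \int[leb n.+1]_x F (tnth x i, dotv x x))%E.
    transitivity (\sum_(i < n.+1) M1)%E.
      by rewrite sumr_const card_ord mule_natl.
    apply: eq_bigr => i _.
    have := dirE (axis i); rewrite enorm_axis expr1n mul1e => <-.
    by apply: eq_integral => x _; rewrite dotv_axis.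
  rewrite -ge0_integral_sum//; last first.
    move=> i; apply: (measurableT_comp mF); apply: measurable_fun_pair => /=.
      exact: measurable_tnth.
    exact: measurable_sqnorm.
  rewrite EFinM -leb_cball// -integral_bool; last exact: measurable_cball.
  have mb : measurable_fun setT (fun x : n.+1.-tuple R => ((enorm x <= r)%R%:R : R)%:E).
    by apply: measurable_EFin_bool; exact: measurable_cball.
  rewrite -ge0_integralZ ?sqr_ge0//.
  apply: ge0_le_integral => //.
  - by move=> x _; apply: sume_ge0.
  - apply: emeasurable_sum => i; apply: (measurableT_comp mF); apply: measurable_fun_pair => /=.
      exact: measurable_tnth.
    exact: measurable_sqnorm.
  - by apply: emeasurable_funM.
  move=> x _; rewrite /F sumEFin -EFinM lee_fin /= -mulr_suml.
  rewrite (_ : \sum_(i < n.+1) _ = dotv x x); last first.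
    by apply: eq_bigr => i _; rewrite expr2.
  by rewrite enorm_le ?(ltW r0)//; case: (leP _ (r ^+ 2)) => h; rewrite /= ?mulr1 ?mulr0.
rewrite FE dirE.
move: M10 sumE; clear dirE; move: M1 => M1; case: M1 => [x|//|//]; rewrite ?lee_fin; last first.
  by rewrite gt0_muley// lte_fin.
move=> x0 h.
have n0 : 0 < (n.+1%:R : R) by rewrite ltr0n.
have -> : enorm k ^+ 2 * r ^+ 2 / n.+1%:R * (omega n.+1 * r ^+ n.+1) =
  enorm k ^+ 2 * (r ^+ 2 * (omega n.+1 * r ^+ n.+1) / n.+1%:R) by ring.
by rewrite ler_wpM2l ?sqr_ge0// ler_pdivlMr// mulrC.
Qed.

End ball_averages_vec.

(** * The Fourier transform of a ball *)

Section parameter_integral.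
Context d1 d2 (T1 : measurableType d1) (T2 : measurableType d2) (R : realType).
Variable m2 : {sigma_finite_measure set T2 -> \bar R}.

(** The integral of a section is the difference of the integrals of its
    positive and negative parts, to which Tonelli's theorem applies. *)
Lemma measurable_fun_Rintegral (F : T1 * T2 -> R) : measurable_fun setT F ->
  measurable_fun setT (fun x => \int[m2]_y F (x, y)).
Proof.
move=> mF; apply: measurableT_comp => //.
have mFE : measurable_fun setT (EFin \o F) by exact/measurable_EFinP.
under eq_fun do rewrite integralE.
apply: emeasurable_funB.
- have := measurable_fun_fubini_tonelli_F (m2 := m2) _
    (measurable_funepos mFE) (fun=> funepos_ge0 _ _).
  by congr (measurable_fun _ _); apply/funext => x; apply: eq_integral => y _; rewrite !funeposE.
- have := measurable_fun_fubini_tonelli_F (m2 := m2) _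
    (measurable_funeneg mFE) (fun=> funeneg_ge0 _ _).
  by congr (measurable_fun _ _); apply/funext => x; apply: eq_integral => y _; rewrite !funenegE.
Qed.

End parameter_integral.

Section ball_fourier.
Context {R : realType}.

Definition cosint d (k : d.-tuple R) (r : R) : R :=
  \int[leb d]_x (cos (dotv k x) * (enorm x <= r)%R%:R).

Lemma measurable_ball_indicator d (r : R) :
  measurable_fun setT (fun x : d.-tuple R => (enorm x <= r)%R%:R : R).
Proof. by apply: measurable_fun_bool; exact: measurable_cball. Qed.

Lemma integrable_ball_indicator d (r : R) : (leb d).-integrable setT
  (fun x => ((enorm x <= r)%R%:R : R)%:E).
Proof.
apply/integrableP; split.
  by apply/measurable_EFinP; exact: measurable_ball_indicator.
under eq_integral do rewrite gee0_abs ?bool_EFin_ge0//.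
rewrite integral_bool; last exact: measurable_cball.
by have := @leb_cball_fin R d r; rewrite ge0_fin_numE.
Qed.

Lemma measurable_cos_dotv d (k : d.-tuple R) :
  measurable_fun setT (fun x => cos (dotv k x)).
Proof. by apply: (measurableT_comp measurable_cos); exact: measurable_dotvl. Qed.

Lemma integrable_cos_ball d (k : d.-tuple R) (r : R) : (leb d).-integrable setT
  (fun x => (cos (dotv k x) * (enorm x <= r)%R%:R)%:E).
Proof.
apply: (le_integrable measurableT _ _ (@integrable_ball_indicator d r)).
  apply/measurable_EFinP; apply: measurable_funM; first exact: measurable_cos_dotv.
  exact: measurable_ball_indicator.
by move=> x _; rewrite lee_fin normrM ler_piMl// cos_max.
Qed.

Lemma cosint_E d (k : d.-tuple R) (r : R) :
  ((cosint k r)%:E = \int[leb d]_x (cos (dotv k x) * (enorm x <= r)%R%:R)%:E)%E.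
Proof.
rewrite /cosint /Rintegral fineK//.
by apply: integrable_fin_num => //; exact: integrable_cos_ball.
Qed.

Lemma integral_1cos_ball d (k : d.-tuple R) (a r : R) :
  (\int[leb d]_x ((1 + a * cos (dotv k x)) * (enorm x <= r)%R%:R)%:E =
   leb d (cball r) + (a * cosint k r)%:E)%E.
Proof.
rewrite EFinM cosint_E -integralZl//; last exact: integrable_cos_ball.
rewrite -integral_bool; last exact: measurable_cball.
rewrite -integralD//; last 2 first.
- exact: integrable_ball_indicator.
- by apply: integrableZl => //; exact: integrable_cos_ball.
by apply: eq_integral => x _; rewrite -EFinM -EFinD mulrDl mul1r mulrA.
Qed.

Lemma cosint0 d r : 0 < r -> cosint (@vzero R d) r = omega d * r ^+ d.
Proof.
move=> r0; apply: EFin_inj; rewrite cosint_E -leb_cball// -integral_bool; last first.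
  exact: measurable_cball.
apply: eq_integral => x _; rewrite (_ : dotv _ _ = 0) ?cos0 ?mul1r//.
by rewrite /dotv big1// => i _; rewrite tnth_mktuple mul0r.
Qed.

(** [cosball_ge] for the weights [1 + cos] and [1 - cos]. *)
Lemma cosint_le d (k : d.-tuple R) r : (0 < d)%N -> 0 < r ->
  `|cosint k r| <= omega d * r ^+ d *
     (1 - Num.min (1 / 4) (enorm k ^+ 2 * r ^+ 2 / (40 * d%:R))).
Proof.
case: d k => // n k _ r0.
have H a : `|a| <= 1 -> omega n.+1 * r ^+ n.+1 *
    Num.min (1 / 4) (enorm k ^+ 2 * r ^+ 2 / (40 * n.+1%:R)) <=
    omega n.+1 * r ^+ n.+1 + a * cosint k r.
  move=> a1; have := cosball_ge k a1 r0.
  by rewrite integral_1cos_ball leb_cball// -EFinD lee_fin.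
have := H 1; have := H (-1); rewrite normrN normr1 lexx => /(_ isT) h1 /(_ isT) h2.
by rewrite ler_norml; apply/andP; split; lra.
Qed.

(** From [1 - cos t <= t ^ 2 / 2] and the second moment of the ball. *)
Lemma cosint_ge d (k : d.-tuple R) r : (0 < d)%N -> 0 < r ->
  omega d * r ^+ d - cosint k r <=
  enorm k ^+ 2 * r ^+ 2 / d%:R / 2 * (omega d * r ^+ d).
Proof.
case: d k => // n k _ r0.
have := integral_1cos_ball k (-1) r; rewrite leb_cball// -EFinD mulN1r => h.
rewrite -lee_fin -h.
have -> : enorm k ^+ 2 * r ^+ 2 / n.+1%:R / 2 * (omega n.+1 * r ^+ n.+1) =
  1 / 2 * (enorm k ^+ 2 * r ^+ 2 / n.+1%:R * (omega n.+1 * r ^+ n.+1)) by ring.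
rewrite EFinM; apply: le_trans (lee_wpmul2l _ (ball_second_moment k r0)); last first.
  by rewrite lee_fin.
have mM : measurable_fun setT (fun x : n.+1.-tuple R => (dotv k x ^+ 2 * (enorm x <= r)%R%:R)%:E).
  apply/measurable_EFinP; apply: measurable_funM; last exact: measurable_ball_indicator.
  by apply: measurable_funX; exact: measurable_dotvl.
rewrite -ge0_integralZ//; last by move=> x; rewrite lee_fin mulr_ge0// sqr_ge0.
apply: ge0_le_integral => //.
- apply/measurable_EFinP; apply: measurable_funM; last exact: measurable_ball_indicator.
  by apply: measurable_funD => //; apply: measurable_funM => //; exact: measurable_cos_dotv.
- by apply: emeasurable_funM.
move=> x _; rewrite -EFinM lee_fin mulrA ler_wpM2r//.
by have := cos_ge (dotv k x); lra.
Qed.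

(** The reflection at the origin exchanges the positive and the negative part
    of the integrand. *)
Lemma sinint0 d (k : d.-tuple R) r :
  \int[leb d]_x (sin (dotv k x) * (enorm x <= r)%R%:R) = 0 :> R.
Proof.
pose f x : \bar R := (sin (dotv k x) * (enorm x <= r)%R%:R)%:E.
change (fine (\int[leb d]_x f x)%E = 0); rewrite integralE.
have mf : measurable_fun setT f.
  apply/measurable_EFinP; apply: measurable_funM; last exact: measurable_ball_indicator.
  apply: (measurableT_comp (continuous_measurable_fun (@continuous_sin R))).
  exact: measurable_dotvl.
have -> : (\int[leb d]_x f^\- x = \int[leb d]_x f^\+ x)%E.
  have n10 : (-1 : R) != 0 by rewrite oppr_eq0 oner_eq0.
  have := ge0_integral_vaff (@vzero R d) n10 (measurable_funepos mf) (fun=> funepos_ge0 _ _).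
  rewrite normrN normr1 expr1n invr1 mul1e => <-.
  apply: eq_integral => x _; rewrite funenegE funeposE /f enormZ normrN normr1 mul1r.
  rewrite (_ : dotv k (vaff (-1) vzero x) = - dotv k x); last first.
    rewrite /dotv -sumrN; apply: eq_bigr => i _; rewrite !tnth_mktuple; ring.
  by rewrite sinN mulNr EFinN.
by case: (\int[leb d]_x f^\+ x)%E => //= x; rewrite subrr.
Qed.

Lemma measurable_cosint d (k : d.-tuple R) : measurable_fun setT (cosint k).
Proof.
apply: (measurable_fun_Rintegral (leb d)
  (F := fun p : R * d.-tuple R => cos (dotv k p.2) * (enorm p.2 <= p.1)%R%:R)).
apply: measurable_funM; first exact: (measurableT_comp (measurable_cos_dotv k)).
apply: measurable_fun_le => //.
exact: (measurableT_comp (@measurable_enorm R d)).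
Qed.

End ball_fourier.

(** * Overlapping balls and threefold convolutions *)

Section overlap.
Context {R : realType}.

(** The factor [sqrt (1 - 1 / 16)] by which [overlap_far] reduces the radius. *)
Definition contraction : R := Num.sqrt (15 / 16).

Lemma contraction_gt0 : 0 < contraction.
Proof. by rewrite sqrtr_gt0; lra. Qed.

Lemma contraction_lt1 : contraction < 1.
Proof. by rewrite -[ltRHS]sqrtr1 ltr_sqrt//; lra. Qed.

Lemma contraction_ge_half : 1 / 2 <= contraction.
Proof.
have e : 0 <= 1 / 2 :> R by lra.
by rewrite -[leLHS]ger0_norm// -sqrtr_sqr ler_wsqrtr//; lra.
Qed.

Lemma half_le_contraction d : (1 / 2) ^+ d <= contraction ^+ d.
Proof.
by rewrite lerXn2r ?nnegrE ?(ltW contraction_gt0) ?contraction_ge_half//; lra.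
Qed.

Lemma vsub_vaff d (x y : d.-tuple R) : vsub x y = vaff (-1) x y.
Proof. by apply: eq_from_tnth => i; rewrite !tnth_mktuple mulN1r addrC. Qed.

Lemma measurable_vsubl d (w : d.-tuple R) : measurable_fun setT (fun z => vsub w z).
Proof.
by rewrite (_ : (fun _ => _) = vaff (-1) w);
  [exact: measurable_vaff|apply/funext => z; exact: vsub_vaff].
Qed.

Lemma measurable_vsubr d (v : d.-tuple R) : measurable_fun setT (fun z => vsub z v).
Proof.
rewrite (_ : (fun _ => _) = vaff 1 (vaff (-1) vzero v)); first exact: measurable_vaff.
by apply/funext => z; apply: eq_from_tnth => i; rewrite !tnth_mktuple; ring.
Qed.

Lemma integral_cball_vaff d a (v : d.-tuple R) r : `|a| = 1 ->
  (\int[leb d]_x ((enorm (vaff a v x) <= r)%R%:R : R)%:E = leb d (cball r))%E.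
Proof.
move=> a1; have a0 : a != 0 by rewrite -normr_eq0 a1 oner_eq0.
have mb : measurable_fun setT (fun x : d.-tuple R => ((enorm x <= r)%R%:R : R)%:E).
  by apply/measurable_EFinP; exact: measurable_ball_indicator.
rewrite (ge0_integral_vaff v a0 mb (fun=> bool_EFin_ge0 _)) a1 expr1n invr1 mul1e.
by rewrite integral_bool//; exact: measurable_cball.
Qed.

(** Two balls of radius [D] whose centres are at least [D / 2] apart: by the
    parallelogram law their intersection lies in the ball of radius
    [D * sqrt (15 / 16)] around the midpoint. *)
Lemma overlap_far d (w : d.-tuple R) D : 0 < D -> D / 2 <= enorm w ->
  (\int[leb d]_z ((enorm z <= D)%R%:R * (enorm (vsub w z) <= D)%R%:R : R)%:E <=
   (omega d * D ^+ d * contraction ^+ d)%:E)%E.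
Proof.
move=> D0 wD; pose v := vaff (- (1 / 2)) (@vzero R d) w.
have c0 := contraction_gt0.
rewrite -mulrA -exprMn -leb_cball ?mulr_gt0// -(@integral_cball_vaff _ 1 v) ?normr1//.
have mD := measurable_vsubl w.
apply: ge0_le_integral => //.
- apply/measurable_EFinP; apply: measurable_funM; first exact: measurable_ball_indicator.
  exact: (measurableT_comp (@measurable_ball_indicator R d _) mD).
- apply/measurable_EFinP.
  exact: (measurableT_comp (@measurable_ball_indicator R d _) (measurable_vaff 1 v)).
move=> z _; rewrite lee_fin.
case: (leP (enorm z) D) => zD; last by rewrite mul0r.
case: (leP (enorm (vsub w z)) D) => wzD; last by rewrite mulr0.
rewrite mul1r.
suff -> : enorm (vaff 1 v z) <= D * contraction by [].
have Dc : 0 <= D * contraction by rewrite mulr_ge0// ltW.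
rewrite enorm_le//.
have par : dotv (vaff 1 v z) (vaff 1 v z) =
    1 / 2 * dotv z z + 1 / 2 * dotv (vsub w z) (vsub w z) - 1 / 4 * dotv w w.
  rewrite /dotv !mulr_sumr -sumrN -!big_split/=; apply: eq_bigr => i _.
  by rewrite !tnth_mktuple; field.
have z2 : dotv z z <= D ^+ 2 by rewrite -enorm_le// ltW.
have w2 : dotv (vsub w z) (vsub w z) <= D ^+ 2 by rewrite -enorm_le// ltW.
have wD2 : (D / 2) ^+ 2 <= dotv w w.
  by rewrite -sqr_enorm lerXn2r ?nnegrE ?enorm_ge0//; lra.
rewrite par exprMn sqr_sqrtr; last by lra.
by move: wD2; rewrite expr_div_n; lra.
Qed.

Lemma overlap_le d (w : d.-tuple R) D : 0 < D ->
  (\int[leb d]_z ((enorm z <= D)%R%:R * (enorm (vsub w z) <= D)%R%:R : R)%:E <=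
   (omega d * D ^+ d)%:E)%E.
Proof.
move=> D0; rewrite -leb_cball// -integral_bool; last exact: measurable_cball.
have mD := measurable_vsubl w.
apply: ge0_le_integral => //.
- apply/measurable_EFinP; apply: measurable_funM; first exact: measurable_ball_indicator.
  exact: (measurableT_comp (@measurable_ball_indicator R d _) mD).
- by apply/measurable_EFinP; exact: measurable_ball_indicator.
- by move=> z _; rewrite lee_fin ler_piMr// lern1 leq_b1.
Qed.

Section triple.
Variables (d : nat) (D : R) (f g h : d.-tuple R -> \bar R).
Hypotheses (D0 : 0 < D).
Hypotheses (mf : measurable_fun setT f) (mg : measurable_fun setT g)
  (mh : measurable_fun setT h).
Hypotheses (f0 : forall x, (0 <= f x)%E) (g0 : forall x, (0 <= g x)%E)
  (h0 : forall x, (0 <= h x)%E).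
Let B (x : d.-tuple R) : \bar R := ((enorm x <= D)%R%:R : R)%:E.
Hypotheses (fB : forall x, (f x <= B x)%E) (gB : forall x, (g x <= B x)%E)
  (hB : forall x, (h x <= B x)%E).

Let mB : measurable_fun setT B.
Proof. by apply/measurable_EFinP; exact: measurable_ball_indicator. Qed.

Let conv_overlap y : (Defs.conv f g y <=
  \int[leb d]_z ((enorm z <= D)%R%:R * (enorm (vsub y z) <= D)%R%:R : R)%:E)%E.
Proof.
apply: ge0_le_integral => //.
- by move=> z _; rewrite mule_ge0.
- by apply: emeasurable_funM => //; exact: (measurableT_comp mg (measurable_vsubl _)).
- rewrite (_ : (fun z => _) = (fun z => B z * B (vsub y z))%E); last by apply/funext.
  by apply: emeasurable_funM => //; exact: (measurableT_comp mB (measurable_vsubl _)).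
- by move=> z _; rewrite EFinM lee_pmul.
Qed.

Let mconv : measurable_fun setT (Defs.conv f g).
Proof.
apply: (measurable_fun_fubini_tonelli_F (m2 := leb d)
  (fun p : d.-tuple R * d.-tuple R => f p.2 * g (vsub p.1 p.2))%E).
  apply: emeasurable_funM; first exact: (measurableT_comp mf).
  exact: (measurableT_comp mg (@measurable_vsub R d)).
by move=> p; rewrite mule_ge0.
Qed.

(** The double convolution is at most the overlap of two balls, which is small
    unless its argument lies in the ball of radius [D / 2], whose volume is
    exponentially small. *)
Lemma triple_conv_le x : (Defs.conv (Defs.conv f g) h x <=
  (2 * (omega d * D ^+ d) ^+ 2 * contraction ^+ d)%:E)%E.
Proof.
set Vo := omega d * D ^+ d.
have Vo0 : 0 <= Vo.
  by rewrite mulr_ge0 ?exprn_ge0 ?fine_ge0// ltW.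
have q0 := contraction_gt0.
have qd0 : 0 <= contraction ^+ d by rewrite exprn_ge0// ltW.
have cfg0 y : (0 <= Defs.conv f g y)%E by apply: integral_ge0 => z _; rewrite mule_ge0.
have B0 y : (0 <= B y)%E by exact: bool_EFin_ge0.
have Vq0 : (0 <= (Vo * contraction ^+ d)%:E)%E by rewrite lee_fin mulr_ge0.
pose b2 (y : d.-tuple R) : \bar R := ((enorm y <= D / 2)%R%:R : R)%:E.
have mb2 : measurable_fun setT b2.
  by apply/measurable_EFinP; exact: measurable_ball_indicator.
have mBx : measurable_fun setT (fun y => B (vsub x y)).
  exact: (measurableT_comp mB (measurable_vsubl x)).
apply: (@le_trans _ _ (\int[leb d]_y (Vo%:E * b2 y +
    (Vo * contraction ^+ d)%:E * B (vsub x y)))%E).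
  apply: ge0_le_integral => //.
  - by move=> y _; rewrite mule_ge0.
  - by apply: emeasurable_funM => //; exact: (measurableT_comp mh (measurable_vsubl _)).
  - by apply: emeasurable_funD; exact: emeasurable_funM.
  move=> y _; have [yD|yD] := leP (enorm y) (D / 2).
    rewrite /b2 yD mule1 -[leLHS]adde0 leeD//; last first.
      by rewrite mule_ge0.
    rewrite -[leRHS]mule1 lee_pmul//.
      exact: le_trans (conv_overlap y) (overlap_le _ _).
    by apply: le_trans (hB _) _; rewrite lee_fin lern1 leq_b1.
  rewrite /b2 (lt_geF yD) mule0 add0e lee_pmul//.
  by apply: le_trans (conv_overlap y) (overlap_far _ _) => //; exact: ltW.
have m1 : measurable_fun setT (fun y => Vo%:E * b2 y)%E by exact: emeasurable_funM.
have m2 : measurable_fun setT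
    (fun y => (Vo * contraction ^+ d)%:E * B (vsub x y))%E by exact: emeasurable_funM.
have b20 y : (0 <= b2 y)%E by exact: bool_EFin_ge0.
rewrite ge0_integralD//; last 2 first.
- by move=> y _; rewrite mule_ge0.
- by move=> y _; rewrite mule_ge0.
rewrite (ge0_integralZ (leb d) Vo0 mb2 b20).
rewrite (ge0_integralZ (leb d) (mulr_ge0 Vo0 qd0) mBx (fun=> B0 _)).
rewrite integral_bool; last exact: measurable_cball.
under [X in (_ + _ * X)%E]eq_integral do rewrite /B vsub_vaff.
rewrite integral_cball_vaff ?normrN ?normr1//.
have D2 : 0 < D / 2 by rewrite divr_gt0.
rewrite [X in (_ * X + _)%E](leb_cball _ D2) leb_cball//.
rewrite -!EFinM -EFinD lee_fin -/Vo expr_div_n.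
have := half_le_contraction d; rewrite expr_div_n expr1n => hq.
have -> : Vo * (omega d * (D ^+ d / 2 ^+ d)) = Vo ^+ 2 * (1 / 2 ^+ d).
  by rewrite /Vo; ring.
have : Vo ^+ 2 * (1 / 2 ^+ d) <= Vo ^+ 2 * contraction ^+ d.
  by rewrite ler_wpM2l ?sqr_ge0.
by lra.
Qed.

End triple.
End overlap.

(** * Quadratic forms of bounded kernels *)

Section quadratic_form.
Context {R : realType} {dE : measure_display} {E : measurableType dE}.
Variable P : probability E R.
Implicit Types (f g : E -> R) (h : E -> E -> R).

Lemma Lfun2P g : g \in Lfun P 2%:E <->
  measurable_fun setT g /\ P.-integrable setT (EFin \o (fun x => g x ^+ 2)).
Proof.
split=> [L|[mg ig]].
  split; last exact: Lfun2_integrable_sqr.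
  by move: L; rewrite inE => /andP[/[!inE]].
rewrite inE; apply/andP; split; rewrite inE//= /finite_norm unlock.
rewrite poweR_lty//; move/integrableP : ig => [_]; apply: le_lt_trans.
rewrite le_eqVlt; apply/orP; left; apply/eqP; apply: eq_integral => x _ /=.
by rewrite powR_mulrn// real_normK ?num_real// ger0_norm ?sqr_ge0.
Qed.

Lemma le_integrableR f g : measurable_fun setT f ->
  P.-integrable setT (EFin \o g) -> (forall x, `|f x| <= g x) ->
  P.-integrable setT (EFin \o f).
Proof.
move=> mf ig fg; apply: le_integrable ig => //; first exact/measurable_EFinP.
by move=> x _; rewrite lee_fin (le_trans (fg x))// ler_norm.
Qed.

Lemma integrableR_cst (c : R) : P.-integrable setT (EFin \o cst c).
Proof.
exact: finite_measure_integrable_cst.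
Qed.

Lemma Rintegral_prob_cst (c : R) : \int[P]_x c = c.
Proof. by rewrite Rintegral_cst// [X in fine X](@probability_setT _ _ _ P) mulr1. Qed.

Lemma Lfun2_measurable g : g \in Lfun P 2%:E -> measurable_fun setT g.
Proof. by move/Lfun2P => []. Qed.

Lemma Lfun2_sqr g : g \in Lfun P 2%:E ->
  P.-integrable setT (EFin \o (fun x => g x ^+ 2)).
Proof. by move/Lfun2P => []. Qed.

Lemma Lfun2_integrable g : g \in Lfun P 2%:E -> P.-integrable setT (EFin \o g).
Proof.
move=> L; apply: (@le_integrableR _ (fun x => 1 + g x ^+ 2)).
- exact: Lfun2_measurable.
- apply: (integrableD _ (integrableR_cst 1) (Lfun2_sqr L)) => //.
move=> x; have := sqr_ge0 (`|g x| - 1); have := sqr_ge0 (`|g x|).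
by rewrite -[g x ^+ 2]real_normK ?num_real//; nra.
Qed.

Lemma Lfun2_normr g : g \in Lfun P 2%:E -> (fun x => `|g x|) \in Lfun P 2%:E.
Proof.
move/Lfun2P => [mg ig]; apply/Lfun2P; split; first exact: measurableT_comp.
by under eq_fun do rewrite /= real_normK ?num_real//.
Qed.

Lemma Lfun2_bounded g M : measurable_fun setT g -> (forall x, `|g x| <= M) ->
  g \in Lfun P 2%:E.
Proof.
move=> mg gM; apply/Lfun2P; split => //.
apply: (le_integrableR _ (integrableR_cst (M ^+ 2))); first exact: measurable_funX.
move=> x; rewrite ger0_norm ?sqr_ge0// -real_normK ?num_real//.
by rewrite lerXn2r ?nnegrE// (le_trans _ (gM x)).
Qed.

Definition sqnorm g : R := \int[P]_a (g a ^+ 2).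

Definition op h g (a : E) : R := \int[P]_b (h a b * g b).

Definition form h g : R := \int[P]_a (g a * op h g a).

Lemma sqnorm_ge0 g : 0 <= sqnorm g.
Proof. by apply: Rintegral_ge0 => x _; rewrite sqr_ge0. Qed.

Section bounded_kernel.
Variables (h : E -> E -> R) (M : R).
Hypothesis mh : measurable_fun setT (fun p : E * E => h p.1 p.2).
Hypothesis hM : forall a b, `|h a b| <= M.

Lemma bound_ge0 (a : E) : 0 <= M.
Proof. by rewrite (le_trans _ (hM a a)). Qed.

Lemma measurable_kernel_section (a : E) : measurable_fun setT (h a).
Proof. exact: (measurableT_comp mh (pair1_measurable a)). Qed.

Lemma integrable_kernel_mul g a : g \in Lfun P 2%:E ->
  P.-integrable setT (EFin \o (fun b => h a b * g b)).
Proof.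
move=> L; apply: (@le_integrableR _ (fun b => M * `|g b|)).
- by apply: measurable_funM; [exact: measurable_kernel_section|exact: Lfun2_measurable].
- have := integrableZl measurableT M (integrable_norm (Lfun2_integrable L)).
  by congr (integrable _ _ _).
- by move=> b; rewrite normrM ler_wpM2r.
Qed.

Lemma measurable_op g : g \in Lfun P 2%:E -> measurable_fun setT (op h g).
Proof.
move=> L; apply: (measurable_fun_Rintegral P (F := fun p : E * E => h p.1 p.2 * g p.2)).
apply: measurable_funM => //.
exact: (measurableT_comp (Lfun2_measurable L)).
Qed.

Lemma op_bound g a : g \in Lfun P 2%:E ->
  `|op h g a| <= M * \int[P]_b `|g b|.
Proof.
move=> L; apply: le_trans (le_normr_Rintegral measurableT (integrable_kernel_mul a L)) _.
have ig := integrable_norm (Lfun2_integrable L).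
rewrite -RintegralZl//; apply: le_Rintegral => //.
- exact: (integrable_norm (integrable_kernel_mul a L)).
- have := integrableZl measurableT M ig; by congr (integrable _ _ _).
- by move=> b _; rewrite normrM ler_wpM2r.
Qed.

Lemma integrable_form g : g \in Lfun P 2%:E ->
  P.-integrable setT (EFin \o (fun a => g a * op h g a)).
Proof.
move=> L; set K := M * \int[P]_b `|g b|.
apply: (@le_integrableR _ (fun b => K * `|g b|)).
- by apply: measurable_funM; [exact: Lfun2_measurable|exact: measurable_op].
- have := integrableZl measurableT K (integrable_norm (Lfun2_integrable L)).
  by congr (integrable _ _ _).
- by move=> b; rewrite normrM mulrC ler_wpM2r// op_bound.
Qed.

(** The form is at most [M] times the square of the mean of [|g|], and the mean
    square exceeds the square of the mean by a variance. *)
Lemma form_le_bound g : g \in Lfun P 2%:E -> form h g <= M * sqnorm g.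
Proof.
move=> L; have ig := Lfun2_integrable L; have ig2 := Lfun2_sqr L.
pose m := \int[P]_b `|g b|.
have m0 : 0 <= m by apply: Rintegral_ge0.
have M0 : 0 <= M by apply: bound_ge0; exact: point.
have mm : m ^+ 2 <= sqnorm g.
  have : 0 <= \int[P]_a (`|g a| - m) ^+ 2.
    by apply: Rintegral_ge0 => x _; rewrite sqr_ge0.
  have -> : \int[P]_a (`|g a| - m) ^+ 2 =
      \int[P]_a (g a ^+ 2 + (- 2 * m * `|g a| + m ^+ 2)).
    apply: eq_Rintegral => x _; rewrite -[g x ^+ 2]real_normK ?num_real//; ring.
  have i1 : P.-integrable setT (EFin \o (fun a => - 2 * m * `|g a|)).
    have := integrableZl measurableT (- 2 * m) (integrable_norm ig).
    by congr (integrable _ _ _).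
  rewrite RintegralD//; last first.
    by have := integrableD measurableT i1 (integrableR_cst (m ^+ 2)).
  rewrite RintegralD//; last exact: integrableR_cst.
  rewrite RintegralZl//; last exact: (integrable_norm ig).
  by rewrite Rintegral_prob_cst -/m -/(sqnorm g); nra.
apply: (@le_trans _ _ (M * m ^+ 2)); last by rewrite ler_wpM2l.
have -> : M * m ^+ 2 = \int[P]_a (M * m * `|g a|).
  by rewrite RintegralZl//; [rewrite -/m; ring|exact: (integrable_norm ig)].
apply: le_Rintegral => //; first exact: integrable_form.
  have := integrableZl measurableT (M * m) (integrable_norm ig).
  by congr (integrable _ _ _).
by move=> a _; rewrite (le_trans (ler_norm _))// normrM mulrC ler_wpM2r// op_bound.
Qed.

End bounded_kernel.

(** Domination: replacing [g] by [|g|] can only increase the form of a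
    nonnegative kernel. *)
Lemma form_le_dominated h h0 M0 m g :
  measurable_fun setT (fun p : E * E => h p.1 p.2) ->
  measurable_fun setT (fun p : E * E => h0 p.1 p.2) ->
  (forall a b, `|h0 a b| <= M0) -> 0 <= m ->
  (forall a b, `|h a b| <= m * h0 a b) -> g \in Lfun P 2%:E ->
  form h g <= m * form h0 (fun a => `|g a|).
Proof.
move=> mh mh0 h0M m0 hh0 L; have L' := Lfun2_normr L.
have hM a b : `|h a b| <= m * M0.
  by rewrite (le_trans (hh0 a b))// ler_wpM2l// (le_trans _ (h0M a b))// ler_norm.
rewrite -RintegralZl//; last exact: integrable_form.
apply: le_Rintegral => //; first exact: integrable_form.
  have := integrableZl measurableT m (integrable_form mh0 h0M L').
  by congr (integrable _ _ _).
move=> a _; rewrite (le_trans (ler_norm _))// normrM mulrCA ler_wpM2l//.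
apply: le_trans (le_normr_Rintegral measurableT (integrable_kernel_mul mh hM a L)) _.
have ih := integrable_kernel_mul mh0 h0M a L'.
rewrite /op -RintegralZl//; apply: le_Rintegral => //.
- exact: (integrable_norm (integrable_kernel_mul mh hM a L)).
- by have := integrableZl measurableT m ih; congr (integrable _ _ _).
- by move=> b _; rewrite normrM mulrA ler_wpM2r.
Qed.

End quadratic_form.

(** * Rayleigh quotients of complex functions *)

Section rayleigh_quotient.
Context {R : realType} {dE : measure_display} {E : measurableType dE}.
Variable P : probability E R.

Section kernel.
Variables (h : E -> E -> R) (hc : E -> E -> R[i]) (M : R).
Hypothesis mh : measurable_fun setT (fun p : E * E => h p.1 p.2).
Hypothesis hM : forall a b, `|h a b| <= M.
Hypothesis hcE : forall a b, hc a b = ((h a b)%:C)%C.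

Lemma int_opE f a : int_op P hc f a =
  (op P h (@complex.Re R \o f) a +i* op P h (@complex.Im R \o f) a)%C.
Proof.
rewrite /int_op /cintegral; congr (_ +i* _)%C; apply: eq_Rintegral => b _;
  rewrite hcE /=; case: (f b) => x y /=; ring.
Qed.

(** For a real kernel the real and the imaginary part of a test function
    decouple. *)
Lemma quotient_formE f : L2 P f ->
  complex.Re (inner P f (int_op P hc f) / inner P f f) =
  (form P h (@complex.Re R \o f) + form P h (@complex.Im R \o f)) /
  (sqnorm P (@complex.Re R \o f) + sqnorm P (@complex.Im R \o f)).
Proof.
move=> [L1 L2]; set f1 := @complex.Re R \o f; set f2 := @complex.Im R \o f.
have -> : inner P f f = ((sqnorm P f1 + sqnorm P f2)%R +i* 0)%C.
  rewrite /inner /cintegral; congr (_ +i* _)%C.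
    rewrite /sqnorm -RintegralD//; [|exact: Lfun2_sqr..].
    apply: eq_Rintegral => a _; rewrite /f1 /f2 /=; case: (f a) => x y /=; ring.
  rewrite -[RHS](Rintegral_prob_cst P); apply: eq_Rintegral => a _.
  by case: (f a) => x y /=; ring.
have -> : inner P f (int_op P hc f) =
    ((form P h f1 + form P h f2)%R +i*
     complex.Im (inner P f (int_op P hc f)))%C.
  rewrite [LHS]/inner /cintegral; congr (_ +i* _)%C.
  rewrite /form -RintegralD//; [|exact: integrable_form..].
  apply: eq_Rintegral => a _; rewrite int_opE -/f1 -/f2.
  by rewrite {1 2}/f1 {1 2}/f2 /=; case: (f a) => x y /=; ring.
set n := _ + sqnorm _ _; set q := _ + form _ _ _; set y := complex.Im _.
have -> : ((q +i* y) / (n +i* 0))%C =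
  ((q +i* y) * (n / (n ^+ 2 + 0 ^+ 2) -i* (0 / (n ^+ 2 + 0 ^+ 2))))%C by [].
rewrite /=; have [->|n0] := eqVneq n 0; first by rewrite invr0 !(mul0r, mulr0, subr0, oppr0).
by field.
Qed.

Lemma sup_spec_le c : 0 <= c ->
  (forall g, g \in Lfun P 2%:E -> form P h g <= c * sqnorm P g) ->
  (sup_spec P (int_op P hc) <= c%:E)%E.
Proof.
move=> c0 hc'; apply: ub_ereal_sup => _ [f [L _] <-].
rewrite lee_fin quotient_formE//; case: L => L1 L2.
set f1 := _ \o f in L1 *; set f2 := _ \o f in L2 *.
have n0 : 0 <= sqnorm P f1 + sqnorm P f2 by rewrite addr_ge0// sqnorm_ge0.
have [->|n1] := eqVneq (sqnorm P f1 + sqnorm P f2) 0; first by rewrite invr0 mulr0.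
rewrite ler_pdivrMr ?lt_neqAle ?n0 1?eq_sym ?n1// mulrDr.
by rewrite lerD// hc'.
Qed.

(** A function that vanishes almost everywhere is not an admissible test
    function; for it the bound holds because its form is zero. *)
Lemma form_le_sup_spec g s : g \in Lfun P 2%:E ->
  (sup_spec P (int_op P hc) <= s%:E)%E -> form P h g <= s * sqnorm P g.
Proof.
move=> L hs; pose f a : R[i] := (g a +i* 0)%C.
have m2 : measurable_fun setT (fun a : E => (0 : R)) by [].
have Lf : L2 P f.
  by split => //; apply: (@Lfun2_bounded _ _ _ _ _ 0) => // x /=; rewrite normr0.
have mg := Lfun2_measurable L.
have n2 : sqnorm P (@complex.Im R \o f) = 0.
  rewrite -[RHS](Rintegral_prob_cst P); apply: eq_Rintegral => a _.
  by rewrite /= expr0n.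
have q2 : form P h (@complex.Im R \o f) = 0.
  rewrite -[RHS](Rintegral_prob_cst P); apply: eq_Rintegral => a _.
  by rewrite /= mul0r.
have [gn0|gn0] := eqVneq (sqnorm P g) 0.
  rewrite gn0 mulr0; have := form_le_bound mh hM L; by rewrite gn0 mulr0.
have g0 : 0 < sqnorm P g by rewrite lt_neqAle eq_sym gn0 sqnorm_ge0.
rewrite -ler_pdivrMr// -lee_fin; apply: le_trans hs; apply: ereal_sup_ubound.
exists f; last first.
  by rewrite quotient_formE// n2 q2 !addr0.
split=> // fae; move/eqP: gn0; apply.
rewrite /sqnorm /Rintegral (@ae_eq_integral _ _ _ P setT (cst 0)%E)//.
- by rewrite integral_cst// mul0e.
- by apply/measurable_EFinP; exact: measurable_funX.
- apply: filterS fae => a /= fa _; move: fa => [->].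
  by rewrite expr0n.
Qed.

(** The test function is the indicator of [A]. *)
Lemma sup_spec_ge A (v p : R) : measurable A -> P A = p%:E -> 0 < p -> 0 <= v ->
  (forall a b, 0 <= h a b) -> (forall a b, A a -> A b -> v <= h a b) ->
  ((v * p)%:E <= sup_spec P (int_op P hc))%E.
Proof.
move=> mA PA p0 v0 h0 hv.
have mI : measurable_fun setT (\1_A : E -> R) by exact: measurable_indic.
have LI : (\1_A : E -> R) \in Lfun P 2%:E.
  apply: (@Lfun2_bounded _ _ _ _ _ 1) => // x.
  by rewrite indicE; case: (x \in A); rewrite ?normr1// normr0.
have IA : \int[P]_a (\1_A a) = p.
  by rewrite /Rintegral integral_indic// setIT [X in fine X]PA.
have nA : sqnorm P \1_A = p.
  rewrite -IA; apply: eq_Rintegral => a _; rewrite indicE.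
  by case: (a \in A); rewrite ?expr1n ?expr0n.
have iI := Lfun2_integrable LI.
have opA a : A a -> v * p <= op P h \1_A a.
  move=> Aa; rewrite -IA -RintegralZl//; apply: le_Rintegral => //.
  - by have := integrableZl measurableT v iI; congr (integrable _ _ _).
  - exact: (integrable_kernel_mul mh hM).
  - move=> b _; rewrite indicE; have [/set_mem Ab|_] := boolP (b \in A).
      by rewrite !mulr1 hv.
    by rewrite !mulr0.
have op0 a : 0 <= op P h \1_A a.
  by apply: Rintegral_ge0 => b _; rewrite mulr_ge0.
have fA : v * p * p <= form P h \1_A.
  rewrite -{2}IA -RintegralZl//; apply: le_Rintegral => //.
  - by have := integrableZl measurableT (v * p) iI; congr (integrable _ _ _).
  - exact: (integrable_form mh hM).
  - move=> a _; rewrite indicE; have [/set_mem Aa|_] := boolP (a \in A).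
      by rewrite mulr1 mul1r opA.
    by rewrite mulr0 mul0r.
rewrite leNgt; apply/negP => hlt.
have vp : 0 <= v * p by rewrite mulr_ge0// ltW.
have [s [s1 s2]] : exists s : R, (sup_spec P (int_op P hc) <= s%:E)%E /\ s < v * p.
  move: hlt; case: (sup_spec _ _) => [s|//|_].
    by rewrite lte_fin => svp; exists s.
  by exists (v * p - 1); split; [rewrite leNye|lra].
have := form_le_sup_spec LI s1; rewrite nA; move: fA.
by move=> /le_trans/[apply]; rewrite ler_pM2r// leNgt s2.
Qed.

End kernel.
End rayleigh_quotient.

(** * The disc model in a fixed dimension *)

Section fixed_dimension.
Context {R : realType} {dE : measure_display} {E : measurableType dE}.
Variable P : probability E R.
Variables (rad : nat -> E -> R) (d : nat) (c D : R).
Hypothesis d0 : (0 < d)%N.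
Hypothesis mrad : measurable_fun setT (rad d).
Hypothesis c0 : 0 < c.
Hypothesis rad_ge : forall a, c * Num.sqrt d%:R <= rad d a.
Hypothesis rad_le : forall a b, rad d a + rad d b <= D.

Local Notation phi := (@boolean_disc R E rad d).
Definition disc_kernel (k : d.-tuple R) (a b : E) : R :=
  cosint k (rad d a + rad d b).
Local Notation h := disc_kernel.

Definition vol : R := omega d * D ^+ d.

(** A factor by which the frequency [k] shrinks every entry of the kernel; it
    involves the radii only through their lower bound. *)
Definition damping (k : d.-tuple R) : R :=
  1 - Num.min (1 / 4) (enorm k ^+ 2 * (c ^+ 2 / 10)).

Let sqd0 : 0 < Num.sqrt d%:R :> R. Proof. by rewrite sqrtr_gt0 ltr0n. Qed.

Lemma radii_gt0 a b : 0 < rad d a + rad d b.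
Proof.
have cs : 0 < c * Num.sqrt d%:R by rewrite mulr_gt0.
by have := rad_ge a; have := rad_ge b; lra.
Qed.

Lemma diameter_gt0 : 0 < D.
Proof. exact: lt_le_trans (radii_gt0 point point) (rad_le _ _). Qed.

Lemma vol_gt0 : 0 < vol.
Proof. by rewrite mulr_gt0 ?omega_gt0// exprn_gt0// diameter_gt0. Qed.

Lemma phi_hatE k a b : phi_hat phi k a b = ((h k a b)%:C)%C.
Proof.
rewrite /phi_hat /cintegral; congr (_ +i* _)%C.
  by apply: eq_Rintegral => x _ /=; rewrite mulr0 subr0.
rewrite -(sinint0 k (rad d a + rad d b)).
by apply: eq_Rintegral => x _ /=; rewrite mulr0 add0r.
Qed.

Lemma measurable_kernel k : measurable_fun setT (fun p : E * E => h k p.1 p.2).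
Proof.
apply: (measurableT_comp (measurable_cosint k)).
by apply: measurable_funD; exact: (measurableT_comp mrad).
Qed.

Lemma kernel0E a b : h vzero a b = omega d * (rad d a + rad d b) ^+ d.
Proof. by rewrite /disc_kernel cosint0 ?radii_gt0. Qed.

Lemma kernel0_ge0 a b : 0 <= h vzero a b.
Proof.
by rewrite kernel0E mulr_ge0 ?exprn_ge0 ?(ltW (radii_gt0 _ _))// ltW// omega_gt0.
Qed.

Lemma kernel0_le a b : h vzero a b <= vol.
Proof.
rewrite kernel0E ler_wpM2l//; first by rewrite ltW// omega_gt0.
rewrite lerXn2r ?nnegrE// ?(ltW (radii_gt0 _ _))//.
exact: ltW diameter_gt0.
Qed.

Lemma normr_kernel0_le a b : `|h vzero a b| <= vol.
Proof. by rewrite ger0_norm ?kernel0_ge0 ?kernel0_le. Qed.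

Lemma damping_ge0 k : 0 <= damping k.
Proof.
rewrite /damping; set m := Num.min _ _.
have : m <= 1 / 4 by rewrite ge_min lexx.
lra.
Qed.

Lemma damping_le1 k : damping k <= 1.
Proof.
rewrite /damping gerBl le_min; apply/andP; split; first lra.
by rewrite mulr_ge0 ?sqr_ge0// divr_ge0 ?sqr_ge0.
Qed.

Lemma kernel_damped k a b : `|h k a b| <= damping k * h vzero a b.
Proof.
have r0 := radii_gt0 a b.
rewrite [leRHS]mulrC kernel0E; apply: le_trans (cosint_le k d0 r0) _.
rewrite ler_wpM2l//; first by rewrite mulr_ge0 ?exprn_ge0 ?ltW// omega_gt0.
rewrite lerD2l lerN2 le_min ge_min lexx/= ge_min; apply/orP; right.
rewrite -mulrA ler_wpM2l ?sqr_ge0//.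
have d1 : 0 < d%:R :> R by rewrite ltr0n.
rewrite ler_pdivlMr; last by lra.
have -> : c ^+ 2 / 10 * (40 * d%:R) = (2 * (c * Num.sqrt d%:R)) ^+ 2.
  by rewrite !exprMn sqr_sqrtr ?ler0n//; field.
rewrite lerXn2r ?nnegrE ?(ltW r0)//.
  by rewrite !mulr_ge0// ltW.
by have := rad_ge a; have := rad_ge b; lra.
Qed.

Lemma S_Phi_hat_real : exists s, S_Phi_hat P phi vzero = s%:E.
Proof.
have S1 : (S_Phi_hat P phi vzero <= vol%:E)%E.
  apply: (sup_spec_le (measurable_kernel vzero) normr_kernel0_le (phi_hatE vzero)).
    exact: ltW vol_gt0.
  by move=> g; exact: (form_le_bound (measurable_kernel vzero) normr_kernel0_le).
have S2 : ((0 * 1)%:E <= S_Phi_hat P phi vzero)%E.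
  apply: (sup_spec_ge (measurable_kernel vzero) normr_kernel0_le (phi_hatE vzero) (A := setT)) => //.
  - exact: probability_setT.
  - exact: kernel0_ge0.
  - by move=> a b _ _; exact: kernel0_ge0.
by move: S1 S2; case: S_Phi_hat => // s _ _; exists s.
Qed.

Variable s : R.
Hypothesis S0 : S_Phi_hat P phi vzero = s%:E.

Lemma S_Phi_hat_ge A (v p : R) : measurable A -> P A = p%:E -> 0 < p -> 0 < v ->
  (forall a, A a -> v <= rad d a + rad d a) -> omega d * v ^+ d * p <= s.
Proof.
move=> mA PA p0 v0 vA; rewrite -lee_fin -S0.
apply: (sup_spec_ge (measurable_kernel vzero) normr_kernel0_le (phi_hatE vzero) mA PA p0).
- by rewrite mulr_ge0 ?exprn_ge0 ?(ltW v0) ?(ltW (omega_gt0 d0)).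
- exact: kernel0_ge0.
- move=> a b Aa Ab; rewrite kernel0E ler_wpM2l ?(ltW (omega_gt0 d0))//.
  rewrite lerXn2r ?nnegrE ?(ltW v0) ?(ltW (radii_gt0 _ _))//.
  by have := vA _ Aa; have := vA _ Ab; lra.
Qed.

Hypothesis s0 : 0 < s.

(** The entrywise damping passes to the spectral supremum by domination. *)
Lemma S_Phi_hat_damped k : (S_Phi_hat P phi k <= (damping k * s)%:E)%E.
Proof.
have hM a b : `|h k a b| <= vol.
  rewrite (le_trans (kernel_damped k a b))// -[leRHS]mul1r ler_pM ?damping_ge0//.
  - exact: kernel0_ge0.
  - exact: damping_le1.
  - exact: kernel0_le.
apply: (sup_spec_le (measurable_kernel k) hM (phi_hatE k)).
  by rewrite mulr_ge0 ?damping_ge0// ltW.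
move=> g L; rewrite -mulrA.
apply: le_trans (form_le_dominated (measurable_kernel k) (measurable_kernel vzero)
  normr_kernel0_le (damping_ge0 k) (kernel_damped k) L) _.
rewrite ler_wpM2l ?damping_ge0//.
have -> : sqnorm P g = sqnorm P (fun a => `|g a|).
  by apply: eq_Rintegral => a _; rewrite real_normK ?num_real.
apply: (form_le_sup_spec (measurable_kernel vzero) normr_kernel0_le (phi_hatE vzero)).
  exact: Lfun2_normr.
by rewrite -S0.
Qed.

Lemma norm_oo_le (u : E -> E -> R[i]) (v : E -> E -> R) B :
  (forall a b, u a b = ((v a b)%:C)%C) -> (forall a b, `|v a b| <= B) ->
  (norm_oo P u <= B%:E)%E.
Proof.
move=> uE vB; apply/ess_supP; apply: aeW => -[a b] /=.
by rewrite uE /= expr0n addr0 sqrtr_sqr lee_fin.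
Qed.

(** The first bound serves for large frequencies, the second one, whose constant
    depends on the dimension only through [D ^+ 2 / d], for small ones. *)
Lemma kernel_diff_le k a b (K : R) : D ^+ 2 <= K * d%:R ->
  `|h vzero a b - h k a b| <=
    Num.min (2 * vol) (enorm k ^+ 2 * (K / 2 * vol)).
Proof.
move=> DK; have r0 := radii_gt0 a b; have V0 := vol_gt0.
have kd := kernel_damped k a b; have k0 := kernel0_le a b.
have k0' := kernel0_ge0 a b; have m0 := damping_ge0 k; have m1 := damping_le1 k.
have hk : `|h k a b| <= h vzero a b.
  by rewrite (le_trans kd)// ler_piMl.
rewrite ger0_norm; last by rewrite subr_ge0 (le_trans (ler_norm _)).
rewrite le_min; apply/andP; split.
  by move: hk; rewrite ler_norml => /andP[]; lra.
rewrite [X in X - _]kernel0E; apply: le_trans (cosint_ge k d0 r0) _.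
rewrite -kernel0E.
have d1 : 0 < d%:R :> R by rewrite ltr0n.
have Kd : (rad d a + rad d b) ^+ 2 / d%:R <= K.
  rewrite ler_pdivrMr// (le_trans _ DK)// lerXn2r ?nnegrE ?(ltW r0)//.
  exact: ltW diameter_gt0.
have q0 : 0 <= (rad d a + rad d b) ^+ 2 / d%:R by rewrite divr_ge0 ?sqr_ge0.
set q := _ / _ in Kd q0.
have -> : enorm k ^+ 2 * (rad d a + rad d b) ^+ 2 / d%:R / 2 * h vzero a b =
    enorm k ^+ 2 * (q * (2^-1 * h vzero a b)) by rewrite /q; ring.
rewrite ler_wpM2l ?sqr_ge0// -mulrA.
by rewrite ler_pM// ?mulr_ge0// ler_wpM2l.
Qed.

Lemma triple_conv_sup_le :
  (triple_conv_sup P phi <= (2 * vol ^+ 2 * contraction ^+ d)%:E)%E.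
Proof.
apply/ess_supP; apply: aeW => -[[[[[[x a1] a2] a3] a4] a5] a6].
have mphi a b : measurable_fun setT (fun y => (phi y a b)%:E).
  by apply/measurable_EFinP; exact: measurable_ball_indicator.
have phi0 a b x' : (0 <= (phi x' a b)%:E)%E by exact: bool_EFin_ge0.
have phiD a b x' : ((phi x' a b)%:E <= ((enorm x' <= D)%R%:R : R)%:E)%E.
  rewrite lee_fin /boolean_disc ler_nat.
  by case: (leP _ (rad d a + rad d b)) => // h; rewrite (le_trans h (rad_le _ _)).
exact: (triple_conv_le diameter_gt0).
Qed.

(** Once both radii are replaced by the maximal range, the mark of the
    intermediate point integrates to one, and the reflection [z = x.1 - u.1] turns
    the integral over its position into the overlap of two balls. *)
Lemma path_integral_le (x y : d.-tuple R * E) :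
  (\int[nu P]_u (phi_X phi x u * phi_X phi u y)%:E <=
   \int[leb d]_z ((enorm z <= D)%R%:R *
     (enorm (vsub (vsub x.1 y.1) z) <= D)%R%:R : R)%:E)%E.
Proof.
pose w := vsub x.1 y.1.
have mB r : measurable_fun setT (fun z : d.-tuple R => (enorm z <= r)%R%:R : R).
  exact: measurable_ball_indicator.
pose G (z : d.-tuple R) : \bar R :=
  ((enorm (vsub x.1 z) <= D)%R%:R * (enorm (vsub z y.1) <= D)%R%:R : R)%:E.
have mG : measurable_fun setT G.
  apply/measurable_EFinP; apply: measurable_funM.
    exact: (measurableT_comp (mB _) (measurable_vsubl _)).
  exact: (measurableT_comp (mB _) (measurable_vsubr _)).
have G0 z : (0 <= G z)%E by rewrite lee_fin mulr_ge0.
have mfst : measurable_fun setT (fun u : d.-tuple R * E => G u.1).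
  exact: (measurableT_comp mG).
apply: (@le_trans _ _ (\int[nu P]_u G u.1)%E).
  apply: ge0_le_integral => //.
  - by move=> u _; rewrite lee_fin mulr_ge0.
  - apply/measurable_EFinP; apply: measurable_funM; apply: measurable_fun_le.
    + exact: (measurableT_comp (@measurable_enorm R d)
        (measurableT_comp (measurable_vsubl x.1) (@measurable_fst _ _ _ E))).
    + by apply: measurable_funD => //; exact: (measurableT_comp mrad).
    + exact: (measurableT_comp (@measurable_enorm R d)
        (measurableT_comp (measurable_vsubr y.1) (@measurable_fst _ _ _ E))).
    + by apply: measurable_funD => //; exact: (measurableT_comp mrad).
  - move=> u _; rewrite lee_fin /phi_X /boolean_disc.
    case: (leP (enorm (vsub x.1 u.1)) _) => h1; last by rewrite mul0r mulr_ge0.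
    case: (leP (enorm (vsub u.1 y.1)) (rad d u.2 + _)) => h2; last by rewrite mulr0 mulr_ge0.
    by rewrite (le_trans h1 (rad_le _ _)) (le_trans h2 (rad_le _ _)) mulr1.
rewrite (fubini_tonelli1 (m1 := leb d) (m2 := P) (fun u => G u.1))//.
under eq_integral do
  rewrite /fubini_F/= integral_cst//= [X in (_ * X)%E](@probability_setT _ _ _ P) mule1.
have mH : measurable_fun setT (fun z => G (vsub x.1 z)).
  exact: (measurableT_comp mG (measurable_vsubl x.1)).
have -> : (\int[leb d]_z G z = \int[leb d]_z G (vsub x.1 z))%E.
  have n10 : (-1 : R) != 0 by rewrite oppr_eq0 oner_eq0.
  have := ge0_integral_vaff x.1 n10 mG G0.
  rewrite normrN normr1 expr1n invr1 mul1e => <-.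
  by apply: eq_integral => z _; rewrite vsub_vaff.
rewrite le_eqVlt; apply/orP; left; apply/eqP; apply: eq_integral => z _.
rewrite /G; congr (_%:R * _%:R)%:E; congr (nat_of_bool (enorm _ <= _)).
  by apply: eq_from_tnth => i; rewrite !tnth_mktuple; ring.
by apply: eq_from_tnth => i; rewrite !tnth_mktuple; ring.
Qed.

Lemma measurable_bad_set t x : measurable (bad_set P phi t x).
Proof.
pose F (y : d.-tuple R * E) : \bar R :=
  (\int[nu P]_u (phi_X phi x u * phi_X phi u y)%:E)%E.
pose G (q : (d.-tuple R * E) * d.-tuple R * E) : \bar R :=
  (phi_X phi x (q.1.2, q.2) * phi_X phi (q.1.2, q.2) q.1.1)%:E.
have G0 q : (0 <= G q)%E by rewrite lee_fin mulr_ge0.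
have mrf dT (T : measurableType dT) (f : T -> E) : measurable_fun setT f ->
  measurable_fun setT (fun p => rad d (f p)) by exact: measurableT_comp.
have mv dT (T : measurableType dT) (f g : T -> d.-tuple R) : measurable_fun setT f ->
    measurable_fun setT g -> measurable_fun setT (fun p => enorm (vsub (f p) (g p))).
  move=> mf mg; apply: (measurableT_comp (@measurable_enorm R d)).
  have mfg := measurable_fun_pair mf mg.
  exact: (measurableT_comp (@measurable_vsub R d) mfg).
have m12 : measurable_fun setT
    (fun q : (d.-tuple R * E) * d.-tuple R * E => q.1.2) by exact: measurableT_comp.
have m11 : measurable_fun setT
    (fun q : (d.-tuple R * E) * d.-tuple R * E => q.1.1) by exact: measurableT_comp.
have mG : measurable_fun setT G.
  apply/measurable_EFinP; apply: measurable_funM; apply: measurable_fun_le.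
  - exact: mv.
  - by apply: measurable_funD => //; exact: (mrf _ _ snd).
  - by apply: mv => //; exact: (measurableT_comp measurable_fst m11).
  - apply: measurable_funD; first exact: (mrf _ _ snd).
    exact: (mrf _ _ _ (measurableT_comp measurable_snd m11)).
have mF : measurable_fun setT F.
  have mH := measurable_fun_fubini_tonelli_F (m2 := P) _ mG G0.
  have H0 p : (0 <= fubini_F P G p)%E by exact: integral_ge0.
  have := measurable_fun_fubini_tonelli_F (m2 := leb d) _ mH H0.
  congr (measurable_fun _ _); apply/funext => y; rewrite /fubini_F /F.
  rewrite [RHS](fubini_tonelli1 (m1 := leb d) (m2 := P)
    (fun u => (phi_X phi x u * phi_X phi u y)%:E))//; last first.
    by move=> u; rewrite lee_fin mulr_ge0.
  have my : measurable_fun setT (fun u : d.-tuple R * E => (y, u.1, u.2)).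
    by apply: measurable_fun_pair => //; exact: measurable_fun_pair.
  rewrite (_ : (fun u => _) = G \o (fun u : d.-tuple R * E => (y, u.1, u.2))).
    exact: measurableT_comp.
  by apply/funext => -[].
have mcF : measurable_fun setT (fun y => (S_Phi_hat P phi vzero)^-1 ^+ 2 * F y)%E.
  by apply: emeasurable_funM => //; exact: mF.
have := emeasurable_fun_o_infty measurableT mcF t%:E.
by rewrite setTI.
Qed.

(** Two points joined by many two-step paths are at distance at most [D / 2], by
    [overlap_far]. *)
Lemma nu_bad_set_le t x : vol * contraction ^+ d <= s ^+ 2 * t ->
  (nu P (bad_set P phi t x) <= (vol * contraction ^+ d)%:E)%E.
Proof.
move=> ht; have D0 := diameter_gt0.
pose B : set (d.-tuple R) := [set y | enorm (vsub x.1 y) <= D / 2].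
have mB : measurable B.
  apply: measurable_set_le => //.
  exact: (measurableT_comp (@measurable_enorm R d) (measurable_vsubl x.1)).
have sub : bad_set P phi t x `<=` B `*` setT.
  move=> y; rewrite /bad_set/= S0 => hy; split => //=; rewrite /B/= leNgt; apply/negP => far.
  move: hy; apply/negP; rewrite -leNgt.
  rewrite inver (gt_eqF s0) -EFinM -expr2.
  apply: (@le_trans _ _ ((s^-1 ^+ 2)%:E * (vol * contraction ^+ d)%:E)%E).
    rewrite lee_wpmul2l ?lee_fin ?sqr_ge0//.
    apply: le_trans (path_integral_le _ _) _.
    by apply: overlap_far => //; exact: ltW.
  by rewrite -EFinM lee_fin exprVn ler_pdivrMl// exprn_gt0.
apply: (@le_trans _ _ (nu P (B `*` setT))).
  apply: le_measure; rewrite ?inE//; first exact: measurable_bad_set.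
  exact: measurableX.
rewrite /nu/= product_measure1E// [X in (_ * X)%E](@probability_setT _ _ _ P) mule1.
rewrite -integral_bool//.
under eq_integral do rewrite vsub_vaff.
rewrite integral_cball_vaff ?normrN ?normr1// leb_cball ?divr_gt0// lee_fin.
rewrite /vol -mulrA ler_wpM2l ?(ltW (omega_gt0 d0))// expr_div_n.
have := @half_le_contraction R d; rewrite expr_div_n expr1n => hq.
have Dd : 0 <= D ^+ d by rewrite exprn_ge0// ltW.
by rewrite ler_wpM2l// -[X in X <= _]mul1r.
Qed.

End fixed_dimension.

(** * Bounds uniform in the dimension *)

Section uniform_constants.
Context {R : realType}.

Lemma Gamma_gt0 d : (0 < d)%N -> 0 < Gamma (d%:R / 2 + 1 : R).
Proof.
move=> d0; have := @omega_Gamma R d d0; have := @omega_gt0 R d d0 => o0 e.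
by rewrite -(pmulr_rgt0 _ o0) e exprn_gt0// sqrtr_gt0 pi_gt0.
Qed.

(** The normalisation in [R_max] cancels the volume of the unit ball. *)
Lemma omega_R_max (V : R) d : (0 < d)%N -> 0 < V ->
  omega d * (2 * R_max V d) ^+ d = V.
Proof.
move=> d0 V0; have G0 := Gamma_gt0 d0.
have dn0 : (d%:R : R) != 0 by rewrite pnatr_eq0 -lt0n.
have root x : 0 <= x -> (x `^ d%:R^-1) ^+ d = x :> R.
  by move=> x0; rewrite -powR_mulrn ?powR_ge0// -powRrM mulVf// powRr1.
have sp : 0 < Num.sqrt pi :> R by rewrite sqrtr_gt0 pi_gt0.
rewrite /R_max !exprMn !root ?(ltW G0) ?(ltW V0)//.
transitivity (V * (omega d * Gamma (d%:R / 2 + 1)) * (2 ^+ d * (2 * Num.sqrt pi)^-1 ^+ d)).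
  by ring.
rewrite omega_Gamma// -exprMn -mulrA -exprMn.
by rewrite (_ : _ * (2 * _) = 1) ?expr1n ?mulr1//; field; rewrite gt_eqF.
Qed.

Lemma R_max_gt0 (V : R) d : (0 < d)%N -> 0 < V -> 0 < R_max V d.
Proof.
move=> d0 V0; rewrite /R_max !mulr_gt0 ?powR_gt0 ?Gamma_gt0//.
by rewrite invr_gt0 mulr_gt0// sqrtr_gt0 pi_gt0.
Qed.

Lemma le_of_exprn_le (x y : R) d : (0 < d)%N -> 0 <= x -> x ^+ d <= y ->
  x <= Num.max 1 y.
Proof.
move=> d0 x0 xy; have [x1|x1] := leP x 1; first by rewrite le_max x1.
by rewrite le_max (le_trans _ xy) ?orbT// -[leLHS]expr1 ler_weXn2l// ltW.
Qed.

(** Compare the volume [V] of the ball with that of its inscribed cube. *)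
Lemma diameter_le (V : R) d : (0 < d)%N -> 0 < V ->
  2 * R_max V d <= Num.max 1 V / 2 * Num.sqrt d%:R.
Proof.
move=> d0 V0; have D0 := R_max_gt0 d0 V0.
have s0 : 0 < Num.sqrt d%:R :> R by rewrite sqrtr_gt0 ltr0n.
have : 2 / Num.sqrt d%:R * (2 * R_max V d) <= Num.max 1 V.
  have x0 : 0 <= 2 / Num.sqrt d%:R * (2 * R_max V d).
    by apply: mulr_ge0; [exact: divr_ge0|apply: mulr_ge0 => //; exact: ltW].
  apply: (le_of_exprn_le d0 x0).
  rewrite exprMn -[leRHS](omega_R_max d0 V0) ler_wpM2r ?omega_ge//.
  by rewrite exprn_ge0// mulr_ge0// ltW.
rewrite mulrAC ler_pdivrMr// => h.
by rewrite mulrAC ler_pdivlMr// mulrC.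
Qed.

Lemma expR_le_pow (x : R) n : (0 < n)%N -> 0 <= x -> x / n%:R <= 1 / 2 ->
  expR (- (2 * x)) <= (1 - x / n%:R) ^+ n.
Proof.
move=> n0 x0 xn; have n1 : (n%:R : R) != 0 by rewrite pnatr_eq0 -lt0n.
have y0 : 0 <= x / n%:R by rewrite divr_ge0.
set y := x / n%:R in xn y0 *.
have -> : - (2 * x) = n%:R * (- (2 * y)) by rewrite /y; field.
rewrite expRM_natl lerXn2r ?nnegrE ?expR_ge0//; first by lra.
rewrite expRN -[leLHS]mul1r ler_pdivrMr ?expR_gt0//.
have := expR_ge1Dx (2 * y); nra.
Qed.

End uniform_constants.

Section boolean_disc_model.
Context {R : realType} {dE : measure_display} {E : measurableType dE}.
Variables (P : probability E R) (rad : nat -> E -> R) (c1 V eps c2 : R).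
Hypothesis mrad : forall d, (0 < d)%N -> measurable_fun setT (rad d).
Hypothesis c1_gt0 : 0 < c1.
Hypothesis V_gt0 : 0 < V.
Hypothesis rad_bounds : forall d, (0 < d)%N -> forall a,
  c1 * Num.sqrt d%:R <= rad d a <= R_max V d.
Hypotheses (eps_gt0 : 0 < eps) (c2_gt0 : 0 < c2).
Hypothesis rad_large : forall d, (0 < d)%N ->
  (eps%:E < P [set a | ((1 - c2 / d%:R) * R_max V d < rad d a)%R])%E.

Local Notation phi := (@boolean_disc R E rad).
Local Notation D d := (2 * R_max V d).
Local Notation VM := (Num.max 1 V).

Let rad_ge d (d0 : (0 < d)%N) a : c1 * Num.sqrt d%:R <= rad d a.
Proof. by have /andP[] := rad_bounds d0 a. Qed.

Let rad_le d (d0 : (0 < d)%N) a b : rad d a + rad d b <= D d.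
Proof. by have /andP[_ ?] := rad_bounds d0 a; have /andP[_ ?] := rad_bounds d0 b; lra. Qed.

Let volE d : (0 < d)%N -> vol d (D d) = V.
Proof. by move=> d0; exact: omega_R_max. Qed.

Let VM1 : 1 <= VM. Proof. by rewrite le_max lexx. Qed.

Let diam2 d : (0 < d)%N -> D d ^+ 2 <= VM ^+ 2 / 4 * d%:R.
Proof.
move=> d0; have h := diameter_le d0 V_gt0; have r0 := R_max_gt0 d0 V_gt0.
have -> : VM ^+ 2 / 4 * d%:R = (VM / 2 * Num.sqrt d%:R) ^+ 2.
  by rewrite !exprMn sqr_sqrtr//; field.
have D0 : 0 <= D d by lra.
by rewrite lerXn2r ?nnegrE// (le_trans D0).
Qed.

(** In high dimension the test function is the indicator of the marks with
    nearly maximal radius; the finitely many remaining dimensions are covered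
    by the constant function and the lower bound on the radii. *)
Lemma S_Phi_hat_uniform : exists2 s0 : R, 0 < s0 &
  forall d, (0 < d)%N -> exists2 s, S_Phi_hat P (@phi d) vzero = s%:E & s0 <= s.
Proof.
pose theta := Num.min 1 (4 * c1 / VM).
have VM0 : 0 < VM by exact: lt_le_trans VM1.
have th0 : 0 < theta by rewrite lt_min ltr01 divr_gt0// mulr_gt0.
pose N := Num.Def.archi_bound (2 * c2).
have N2 : 2 * c2 < N%:R by apply: archi_boundP; rewrite mulr_ge0// ltW.
exists (Num.min (eps * (V * expR (- (2 * c2)))) (V * theta ^+ N)).
  by rewrite lt_min !mulr_gt0 ?expR_gt0 ?exprn_gt0.
move=> d d0; have r0 := R_max_gt0 d0 V_gt0.
have dd : 0 < d%:R :> R by rewrite ltr0n.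
have sd : 0 < Num.sqrt d%:R :> R by rewrite sqrtr_gt0.
have [s S0] := S_Phi_hat_real P d0 (mrad d0) c1_gt0 (rad_ge d0) (rad_le d0).
exists s => //.
have Sge := S_Phi_hat_ge d0 (mrad d0) c1_gt0 (rad_ge d0) (rad_le d0) S0.
have [dN|Nd] := leqP d N.
  (* The range of two discs is at least [theta] times [D], so that every
     entry of the kernel is at least [V * theta ^+ d]. *)
  rewrite ge_min; apply/orP; right.
  pose v := 2 * (c1 * Num.sqrt d%:R).
  have v0 : 0 < v by rewrite !mulr_gt0.
  have := Sge setT v 1 measurableT (probability_setT P) ltr01 v0.
  rewrite mulr1 => h; apply: le_trans (h _); last first.
    by move=> a _; have := rad_ge d0 a; rewrite /v; lra.
  apply: (@le_trans _ _ (V * theta ^+ d)).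
    by rewrite ler_wpM2l ?(ltW V_gt0)// ler_wiXn2l ?(ltW th0)// ge_min lexx.
  rewrite -[X in X * _](omega_R_max d0 V_gt0) -mulrA -exprMn.
  rewrite ler_wpM2l ?(ltW (omega_gt0 d0))// lerXn2r ?nnegrE ?(ltW v0)//.
    by rewrite mulr_ge0 ?(ltW th0)//; lra.
  apply: (@le_trans _ _ (VM / 2 * Num.sqrt d%:R * (4 * c1 / VM))).
    apply: ler_pM; rewrite ?(ltW th0)//; first by rewrite mulr_ge0// ltW.
      exact: diameter_le.
    by rewrite ge_min lexx orbT.
  rewrite le_eqVlt; apply/orP; left; apply/eqP; rewrite /v; field.
  by rewrite gt_eqF.
(* On [A] the range of two discs is at least [(1 - c2 / d) * D], and this
   factor costs at most [expR (- (2 * c2))] in volume as [c2 / d <= 1 / 2]. *)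
rewrite ge_min; apply/orP; left.
set A := [set a | ((1 - c2 / d%:R) * R_max V d < rad d a)%R].
have cd : c2 / d%:R <= 1 / 2.
  rewrite ler_pdivrMr//; have : N%:R <= d%:R :> R by rewrite ler_nat ltnW.
  lra.
have mA : measurable A.
  rewrite (_ : A = ~` [set a | rad d a <= (1 - c2 / d%:R) * R_max V d]).
    by apply: measurableC; apply: measurable_set_le => //; exact: mrad.
  by apply/seteqP; split => a; rewrite /A /= ltNge => /negP.
pose p := fine (P A).
have PA : P A = p%:E by rewrite fineK// fin_num_measure.
have pe : eps < p by rewrite -lte_fin -PA; exact: rad_large.
have p0 : 0 < p by exact: lt_trans pe.
pose v := 2 * ((1 - c2 / d%:R) * R_max V d).
have x0 : 0 < 1 - c2 / d%:R by lra.
have v0 : 0 < v by apply: mulr_gt0 => //; exact: mulr_gt0.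
have h : omega d * v ^+ d * p <= s.
  by apply: (Sge A) => // a; rewrite /A/= /v => ha; lra.
apply: le_trans h; rewrite mulrC ler_pM ?(ltW eps_gt0) ?(ltW pe)//.
  by rewrite mulr_ge0 ?expR_ge0 ?(ltW V_gt0).
have -> : v = (1 - c2 / d%:R) * (2 * R_max V d) by rewrite /v; ring.
rewrite exprMn mulrCA omega_R_max// mulrC ler_wpM2r ?(ltW V_gt0)//.
by apply: expR_le_pow => //; exact: ltW.
Qed.

(** The damping never falls below 3 / 4 and is quadratic at the origin. *)
Lemma H2_boolean_disc : H2 P (@boolean_disc R E rad).
Proof.
have [s0 s0_gt0 HS] := S_Phi_hat_uniform.
exists (3 / 4), (c1 ^+ 2 / 10); split; [lra|lra|by rewrite divr_gt0// exprn_gt0|].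
move=> d d0 k; have [s S0 ss] := HS d d0.
have sgt0 : 0 < s by exact: lt_le_trans ss.
have Sk := S_Phi_hat_damped d0 (mrad d0) c1_gt0 (rad_ge d0) (rad_le d0) S0 sgt0 k.
rewrite S0 inver (gt_eqF sgt0).
apply: (@le_trans _ _ ((damping c1 k * s)%:E * (s^-1)%:E)%E).
  by rewrite lee_wpmul2r// lee_fin invr_ge0 ltW.
rewrite -EFinM lee_fin mulfK ?gt_eqF// /damping le_max.
have [h|h] := leP (1 / 4) (enorm k ^+ 2 * (c1 ^+ 2 / 10)).
  by apply/orP; left; lra.
by apply/orP; right; lra.
Qed.

Lemma H1_boolean_disc : H1 P (@boolean_disc R E rad).
Proof.
have [s0 s0_gt0 HS] := S_Phi_hat_uniform.
split=> [d d0|].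
  by have [s -> _] := HS d d0; rewrite ltry.
have q0 : 0 < c1 ^+ 2 / 10 by rewrite divr_gt0// exprn_gt0.
(* In [C], the term [8 * V] covers the frequencies at which the damping has
   saturated, where the entries differ by at most [2 * V = 8 * V * (1 / 4)]; the
   other term covers the small frequencies. *)
pose B := VM ^+ 2 / 4 / 2 * V.
have B0 : 0 <= B.
  apply: mulr_ge0; last exact: ltW.
  by do 2![apply: divr_ge0 => //]; exact: sqr_ge0.
pose C := (8 * V + B / (c1 ^+ 2 / 10)) / s0.
have Bq : 0 <= B / (c1 ^+ 2 / 10) by apply: divr_ge0 => //; exact: ltW.
have C0 : 0 < C by apply: divr_gt0 => //; have := V_gt0; lra.
exists C; split => // d d0; have [s S0 ss] := HS d d0.
have sgt0 : 0 < s by exact: lt_le_trans ss.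
have Cs : 8 * V + B / (c1 ^+ 2 / 10) <= C * s.
  apply: (@le_trans _ _ (C * s0)); first by rewrite divfK// gt_eqF.
  by rewrite ler_wpM2l// ltW.
split.
  rewrite S0 -EFinM.
  apply: (norm_oo_le P (v := disc_kernel rad vzero)) => [a b|a b].
    exact: phi_hatE.
  rewrite (le_trans (normr_kernel0_le d0 c1_gt0 (rad_ge d0) (rad_le d0) _ _))//.
  by rewrite volE//; have := V_gt0; lra.
move=> k.
have Sk := S_Phi_hat_damped d0 (mrad d0) c1_gt0 (rad_ge d0) (rad_le d0) S0 sgt0 k.
apply: (@le_trans _ _ (C%:E * (s%:E - (damping c1 k * s)%:E))%E); last first.
  by rewrite S0 lee_wpmul2l ?lee_fin ?(ltW C0)// leeB.
rewrite -EFinB -EFinM.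
apply: (norm_oo_le P (v := fun a b => disc_kernel rad vzero a b - disc_kernel rad k a b)).
  by move=> a b; rewrite !phi_hatE rmorphB.
move=> a b; apply: le_trans (kernel_diff_le d0 c1_gt0 (rad_ge d0) (rad_le d0) k a b (diam2 d0)) _.
rewrite volE// /damping.
have -> : C * (s - (1 - Num.min (1 / 4) (enorm k ^+ 2 * (c1 ^+ 2 / 10))) * s) =
  C * s * Num.min (1 / 4) (enorm k ^+ 2 * (c1 ^+ 2 / 10)) by ring.
have [h|h] := leP (1 / 4) (enorm k ^+ 2 * (c1 ^+ 2 / 10)).
  by rewrite ge_min; apply/orP; left; have := V_gt0; lra.
rewrite ge_min; apply/orP; right.
apply: (@le_trans _ _ (B / (c1 ^+ 2 / 10) * (enorm k ^+ 2 * (c1 ^+ 2 / 10)))).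
  rewrite le_eqVlt; apply/orP; left; apply/eqP; rewrite -/B; field.
  by rewrite gt_eqF.
rewrite ler_wpM2r//; last by have := V_gt0; lra.
by rewrite mulr_ge0 ?sqr_ge0 ?(ltW q0).
Qed.

Lemma H3_boolean_disc : H3 P (@boolean_disc R E rad).
Proof.
have [s0 s0_gt0 HS] := S_Phi_hat_uniform.
have q0 := @contraction_gt0 R; have q1 := @contraction_lt1 R.
have V0 := V_gt0.
(* [a3] serves for the triple convolution, [a2] makes the threshold of the bad
   sets large enough for [nu_bad_set_le], and [V] bounds their measure. *)
pose a3 := s0^-1 ^+ 3 * (2 * V ^+ 2); pose a2 := s0 ^- 2 * V.
have a30 : 0 < a3 by rewrite !mulr_gt0 ?exprn_gt0 ?invr_gt0.
have a20 : 0 < a2 by rewrite !mulr_gt0 ?invr_gt0 ?exprn_gt0.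
pose G := a3 + a2 + V.
have G0 : 0 < G by rewrite /G; lra.
exists (fun d => G * contraction ^+ d); split.
- by move=> d; rewrite mulr_ge0 ?(ltW G0)// exprn_ge0// ltW.
- rewrite -[0](mulr0 G); apply: cvgM; [exact: cvg_cst|apply: cvg_expr].
  by rewrite gtr0_norm.
move=> d d0; have [s S0 ss] := HS d d0.
have sgt0 : 0 < s by exact: lt_le_trans ss.
have qd : 0 <= contraction ^+ d :> R by rewrite exprn_ge0// ltW.
split.
  rewrite S0 inver (gt_eqF sgt0) -EFin_expe.
  apply: (@le_trans _ _ ((s^-1 ^+ 3)%:E * (2 * V ^+ 2 * contraction ^+ d)%:E)%E).
    rewrite lee_wpmul2l// ?lee_fin ?exprn_ge0 ?invr_ge0 ?(ltW sgt0)//.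
    rewrite -(volE d0).
    exact: (triple_conv_sup_le P d0 c1_gt0 (rad_ge d0) (rad_le d0)).
  rewrite -EFinM lee_fin mulrA ler_wpM2r//.
  apply: (@le_trans _ _ a3); last by rewrite /G; lra.
  apply: ler_wpM2r; first by apply: mulr_ge0 => //; exact: sqr_ge0.
  rewrite lerXn2r ?nnegrE ?invr_ge0 ?(ltW sgt0) ?(ltW s0_gt0)//.
  by rewrite lef_pV2.
apply/ess_supP; apply: aeW => x.
apply: le_trans (nu_bad_set_le d0 (mrad d0) c1_gt0 (rad_ge d0) (rad_le d0) S0 sgt0 _ _) _.
  rewrite volE// mulrA ler_wpM2r//.
  apply: (@le_trans _ _ (s0 ^+ 2 * a2)).
    by rewrite /a2 mulrA divff ?mul1r// expf_neq0// gt_eqF.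
  apply: ler_pM; rewrite ?sqr_ge0 ?(ltW a20)//.
    by rewrite lerXn2r ?nnegrE ?(ltW sgt0) ?(ltW s0_gt0).
  by rewrite /G; lra.
by rewrite volE// lee_fin ler_wpM2r// /G; lra.
Qed.

End boolean_disc_model.

Theorem lemmaB4 (R : realType)
    (Sigma : set (set (unit_itv R))) (hSigma : sigma_algebra setT Sigma)
    (P : probability (g_sigma_algebraType Sigma) R)
    (hsep : separable_measure P)
    (rad : nat -> g_sigma_algebraType Sigma -> R)
    (hrad_meas : forall d, (0 < d)%N -> measurable_fun setT (rad d))
    (hrad_ge0 : forall d, (0 < d)%N -> forall a, 0 <= rad d a)
    (c1 V : R) (hc1 : 0 < c1 < (Num.sqrt (8 * pi * expR 1))^-1) (hV : 0 < V)
    (hrad_bounds : forall d, (0 < d)%N -> forall a,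
      c1 * Num.sqrt d%:R <= rad d a <= R_max V d)
    (eps c2 : R) (heps : 0 < eps) (hc2 : 0 < c2)
    (hrad_large : forall d, (0 < d)%N ->
      (eps%:E < P [set a | ((1 - c2 / d%:R) * R_max V d < rad d a)%R])%E) :
  AssumptionH P (boolean_disc rad).
Proof.
have /andP[c1_gt0 _] := hc1.
split.
- exact: (H1_boolean_disc hrad_meas c1_gt0 hV hrad_bounds heps hc2 hrad_large).
- exact: (H2_boolean_disc hrad_meas c1_gt0 hV hrad_bounds heps hc2 hrad_large).
- exact: (H3_boolean_disc hrad_meas c1_gt0 hV hrad_bounds heps hc2 hrad_large).
Qed.
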